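(* As $x\to\infty$, $$\#\{n\le x:\varphi(n)=\varphi(n+1)\}\ll x\exp\!\left\{-(\tfrac12-o(1))\sqrt{\log x\,\log_2 x}\right\}.$$
   Context: $\varphi$ is Euler's totient function, $n$ ranges over positive integers, and $\log_2 x=\log\log x$. *)

(* Defs.v *)
From mathcomp Require Import all_boot all_order all_algebra.
From mathcomp Require Import all_classical all_reals all_analysis.

Set Implicit Arguments.
Unset Strict Implicit.
Unset Printing Implicit Defensive.

Import Order.TTheory GRing.Theory Num.Theory.
Import numFieldNormedType.Exports.

Local Open Scope classical_set_scope.
Local Open Scope ring_scope.

(* #{n <= x : phi(n) = phi(n+1)} for real x, n ranging over the integers
   1, ..., floor x; [Num.truncn x] is floor x for x >= 0 and 0 for x < 0. *)
Definition totient_coincidences (R : realType) (x : R) : nat :=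
  count (fun n : nat => totient n == totient n.+1)
        (index_iota 1 (Num.truncn x).+1).

Definition loglog (R : realType) (x : R) : R := ln (ln x).

(* Makes the filter of neighbourhoods of +oo usable in [f =O_ F g]. *)
Canonical pinfty_nbhs_filter_on (R : realType) :=
  FilterType (pinfty_nbhs R) (@filter_filter _ _ (proper_pinfty_nbhs (R := R))).

(* Main.v *)
Require Import Defs.
From mathcomp Require Import all_boot all_order all_algebra.
From mathcomp Require Import all_classical all_reals all_analysis.
From mathcomp Require Import ring lra zify.

Set Implicit Arguments.
Unset Strict Implicit.
Unset Printing Implicit Defensive.

Import Order.TTheory GRing.Theory Num.Theory.
Import numFieldNormedType.Exports.

Local Open Scope classical_set_scope.
Local Open Scope ring_scope.

(* Let Q = sqrt (log x log log x) and s ~ exp (Q / 2).  Call n good when some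
   prime p > s^2 divides it exactly once.  A number n <= x that is not good
   either has a square divisor d^2 with d >= s, or is at most x / s, or has at
   least k ~ sqrt (log x / log log x) distinct prime factors; the last case is
   handled by weighting with A^omega(n) for A ~ sqrt (log x) / log log x, since
   the sum of A^omega(n) / n over n <= x is at most H_x^A.
   If n and n + 1 are both good, write {n, n + 1} = {m p, m' p'} with p < p',
   g = gcd (p - 1, p' - 1), p - 1 = a g and p' - 1 = a' g.  Then
   phi(m) (p - 1) = phi(m') (p' - 1) forces a | phi(m').
   - If g s <= p', then m', a and g determine m' p' modulo m' g p, and summing
     over a | phi(m') costs the sum of 1 / m' over a | phi(m') with weight
     1 / max (s, a) <= s^(e-1) a^(-e).  The exponent e > 0 makes Rankin's trick
     work without any information on the distribution of primes.
   - If g s > p', then g >= s and a, a' <= s.  When m <= s^2 the pair (m, m')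
     determines (p, p') from two linear equations; otherwise (a, a', g)
     determines m' p' modulo p p'. *)

(** * Elementary sums: inverse squares, harmonic numbers, truncated zeta sums *)

Lemma sum_le_telescope (R : numDomainType) (u f : nat -> R) (m n : nat) :
  (m <= n)%N -> (forall i, (m <= i < n)%N -> u i <= f i.+1 - f i) ->
  \sum_(m <= i < n) u i <= f n - f m.
Proof.
move=> mn uf; rewrite -(telescope_sumr f mn) big_nat_cond [leRHS]big_nat_cond.
by apply: ler_sum => i; rewrite andbT => /uf.
Qed.

(** Telescoping against [- (2 / d)]: the factor 2 makes [1/d^2 <= 2/d - 2/(d+1)] true from [d = 1]
    on. *)
Lemma sum_inv_square_le (R : realFieldType) (s n : nat) : (0 < s)%N ->
  \sum_(s <= d < n) (d%:R ^- 2 : R) <= 2 / s%:R.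
Proof.
move=> s0; have s0' : 0 < s%:R :> R by rewrite ltr0n.
have [sn|ns] := leqP s n; last first.
  by rewrite big_geq ?divr_ge0 ?ler0n// ltnW.
apply: (le_trans (sum_le_telescope (f := fun d => - (2 / d%:R)) sn _)).
  move=> d /andP[sd _].
  have d0 : 1 <= d%:R :> R by rewrite ler1n (leq_trans s0).
  have -> : d.+1%:R = d%:R + 1 :> R by rewrite natr1.
  rewrite opprK -subr_ge0.
  set t : R := d%:R in d0 *.
  have -> : - (2 / (t + 1)) + 2 / t - t ^- 2 =
     (t - 1) / (t ^+ 2 * (t + 1)) by field; lra.
  by rewrite divr_ge0 ?subr_ge0// mulr_ge0 ?exprn_ge0//; lra.
have : 0 <= 2 / n%:R :> R by rewrite divr_ge0 ?ler0n.
lra.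
Qed.

Section Real.
Variable R : realType.
Implicit Types (e t : R) (n s : nat).

Definition harm n : R := \sum_(1 <= i < n.+1) i%:R^-1.

Lemma harm_ge1 n : (0 < n)%N -> 1 <= harm n.
Proof.
by move=> n0; rewrite /harm big_nat_recl// invr1 lerDl sumr_ge0.
Qed.

Lemma harm_le m n : (m <= n)%N -> harm m <= harm n.
Proof.
move=> mn; rewrite /harm [leRHS](@big_cat_nat _ _ _ m.+1)//= lerDl.
by apply: sumr_ge0 => i _; rewrite invr_ge0 ler0n.
Qed.

(** This is [ln (1 - 1/n) <= - 1/n]. It replaces comparison with an integral for both the harmonic
    and the zeta sums. *)
Lemma ln_pred_le n : (1 < n)%N -> ln (n.-1%:R : R) <= ln (n%:R) - n%:R^-1.
Proof.
move=> n1; have n0 : 0 < n%:R :> R by rewrite ltr0n ltnW.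
have -> : n.-1%:R = n%:R * (1 - n%:R^-1) :> R.
  by rewrite mulrBr mulr1 mulfV ?gt_eqF// -subn1 natrB// ltnW.
have ? : 0 < 1 - n%:R^-1 :> R by rewrite subr_gt0 invf_lt1// ltr1n.
rewrite lnM ?posrE// lerD2l; apply: le_trans (le_ln1Dx _) _ => //.
by rewrite ltrN2 invf_lt1// ltr1n.
Qed.

Lemma harm_le_ln n : (0 < n)%N -> harm n <= 1 + ln (n%:R : R).
Proof.
move=> n0; rewrite /harm big_nat_recl// invr1 lerD2l.
have := sum_le_telescope (u := fun i => i.+1%:R^-1) (f := fun i => ln (i%:R : R)) n0.
rewrite ln1 subr0; apply => i /andP[i1 _].
have := @ln_pred_le i.+1 i1; rewrite /= => h.
by rewrite lerBrDl -lerBrDr.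
Qed.

Definition zsum t n : R := \sum_(1 <= i < n.+1) i%:R `^ (- (1 + t)).

Lemma zsum_ge0 t n : 0 <= zsum t n.
Proof. by apply: sumr_ge0 => i _; rewrite powR_ge0. Qed.

Lemma zsum_le t n : 0 < t -> zsum t n <= 1 + t^-1.
Proof.
move=> t0; case: n => [|n].
  by rewrite /zsum big_geq// addr_ge0// invr_ge0 ltW.
rewrite /zsum big_nat_recl// powR1 lerD2l.
have n1 : (1 <= n.+1)%N by [].
apply: (le_trans (sum_le_telescope (f := fun i => - (t^-1 * i%:R `^ (- t))) n1 _)).
  move=> i /andP[i1 _]; rewrite opprK.
  have i0 : 0 < i.+1%:R :> R by [].
  have i0' : 0 < i%:R :> R by rewrite ltr0n.
  have -> : i.+1%:R `^ (- (1 + t)) = i.+1%:R `^ (- t) / i.+1%:R.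
    rewrite opprD addrC powRD; last by rewrite [_.+1%:R == 0]gt_eqF//= implybT.
    by rewrite powR_inv1// ltW.
  (* From [1 + u <= expR u] with [u = t / (i + 1)] and the previous bound on [ln i]; after division
     by [t] this is the telescoping inequality. *)
  have K : i.+1%:R `^ (- t) * (1 + t / i.+1%:R) <= i%:R `^ (- t).
    rewrite /powR !gt_eqF// -lter_pdivlMl ?expR_gt0// -expRN -expRD.
    apply: le_trans (expR_ge1Dx _) _; rewrite ler_expR.
    have := @ln_pred_le i.+1 i1; rewrite /= => h.
    rewrite !mulNr opprK -mulrBr ler_wpM2l ?(ltW t0)//.
    by rewrite lerBrDl -lerBrDr.
  have -> : i.+1%:R `^ (- t) / i.+1%:R =
     t^-1 * (i.+1%:R `^ (- t) * (1 + t / i.+1%:R)) - t^-1 * i.+1%:R `^ (- t).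
    by field; rewrite gt_eqF//= addrC natr1 gt_eqF.
  by rewrite addrC lerD2l ler_wpM2l// invr_ge0 ltW.
rewrite powR1 mulr1 opprK gerDr oppr_le0.
by rewrite mulr_ge0 ?powR_ge0// invr_ge0 ltW.
Qed.
End Real.

(** * Rearranging sums over divisors and multiples *)

Lemma ler_sum_subset (R : numDomainType) (I : eqType) (r s : seq I) (F : I -> R) :
  (forall i, 0 <= F i) -> uniq r -> {subset r <= s} ->
  \sum_(i <- r) F i <= \sum_(i <- s) F i.
Proof.
move=> F0; elim: r s => [|x r IH] s /=.
  by move=> _ _; rewrite big_nil sumr_ge0.
move=> /andP[xr ur] rs; have xs : x \in s by apply: rs; rewrite mem_head.
rewrite big_cons (big_rem x xs)/= lerD2l IH// => y yr.
have yx : y != x by apply: contraNneq xr => <-.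
have := rs y; rewrite inE yr orbT => /(_ isT) ys.
by move: ys; rewrite (perm_mem (perm_to_rem xs)) inE (negbTE yx).
Qed.

(** A pair [(d, e)] arises on the left from [m = d * e] only, so at most once; on the right the
    condition [d * e <= M] is dropped. *)
Lemma sum_divisors_convolution (R : numDomainType) (F : nat -> nat -> R) (M : nat) :
  (forall d e, 0 <= F d e) ->
  \sum_(1 <= m < M.+1) \sum_(d <- divisors m) F d (m %/ d)%N <=
  \sum_(1 <= d < M.+1) \sum_(1 <= e < M.+1) F d e.
Proof.
move=> F0.
apply: (@le_trans _ _ (\sum_(1 <= m < M.+1) \sum_(1 <= d < M.+1)
     \sum_(1 <= e < M.+1) (d * e == m)%N%:R * F d e)).
  rewrite big_nat_cond [leRHS]big_nat_cond; apply: ler_sum => m.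
  rewrite andbT => /andP[m0 mM].
  apply: (@le_trans _ _ (\sum_(d <- divisors m) \sum_(1 <= e < M.+1)
     (d * e == m)%N%:R * F d e)).
    rewrite big_seq [leRHS]big_seq; apply: ler_sum => d.
    rewrite -dvdn_divisors// => dm.
    have d0 : (0 < d)%N := dvdn_gt0 m0 dm.
    rewrite (bigD1_seq (m %/ d)%N)/= ?iota_uniq//.
      rewrite mulnC divnK// eqxx mul1r lerDl sumr_ge0// => e _.
      by rewrite mulr_ge0 ?ler0n.
    by rewrite mem_index_iota divn_gt0// dvdn_leq//= (leq_ltn_trans _ mM)// leq_div.
  apply: ler_sum_subset => [d||d].
  - by apply: sumr_ge0 => e _; rewrite mulr_ge0 ?ler0n.
  - exact: divisors_uniq.
  - rewrite -dvdn_divisors// mem_index_iota => dm.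
    by rewrite (dvdn_gt0 m0 dm)/= (leq_ltn_trans _ mM)// dvdn_leq.
rewrite exchange_big/=; apply: ler_sum => d _.
rewrite exchange_big/=; apply: ler_sum => e _.
rewrite -mulr_suml ler_piMl//.
have [de|de] := boolP ((d * e)%N \in index_iota 1 M.+1).
  rewrite (bigD1_seq _ de)/= ?iota_uniq// eqxx big1 ?addr0// => i.
  by rewrite eq_sym => /negbTE ->.
rewrite big_seq big1 ?ler01// => i iM.
by case: eqP iM de => // -> ->.
Qed.

Lemma sum_multiples_le (R : numDomainType) (F : nat -> R) (r M : nat) :
  (0 < r)%N -> (forall m, 0 <= F m) ->
  \sum_(1 <= m < M.+1 | (r %| m)%N) F m <= \sum_(1 <= m < M.+1) F (r * m)%N.
Proof.
move=> r0 F0; rewrite -big_filter -(big_map (muln r) xpredT F).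
apply: ler_sum_subset => // [|m]; first by rewrite filter_uniq ?iota_uniq.
rewrite mem_filter mem_index_iota => /andP[/dvdnP[k ->]].
rewrite muln_gt0 => /andP[/andP[k0 _] kM].
apply/mapP; exists k; last by rewrite mulnC.
by rewrite mem_index_iota k0 (leq_ltn_trans _ kM)// leq_pmulr.
Qed.

(** * The number of distinct prime factors and its exponential weights *)

Lemma prod_primes m : (0 < m)%N -> m = (\prod_(q <- primes m) q ^ logn q m)%N.
Proof.
by move=> m0; rewrite {1}(prod_prime_decomp m0) prime_decompE big_map.
Qed.

Definition omega (n : nat) : nat := size (primes n).

Lemma omega_primeM (q e d : nat) : prime q -> (0 < e)%N -> (0 < d)%N ->
  ~~ (q %| d)%N -> omega (q ^ e * d) = (omega d).+1.
Proof.
move=> pq e0 d0 qd; rewrite /omega -[RHS]/(size (q :: primes d)).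
apply/perm_size/uniq_perm; rewrite /= ?primes_uniq// ?andbT.
  by rewrite mem_primes pq d0.
have qe0 : (0 < q ^ e)%N by rewrite expn_gt0 prime_gt0.
by move=> r; rewrite primesM// inE primesX// primes_prime// inE.
Qed.

(** The left side equals the sum of [A ^ omega d] over squarefree [d] dividing [m]. By induction:
    strip the full power of the least prime [q], leaving [n]; the divisors of [n] and their
    multiples by [q] are distinct divisors of [m]. *)
Lemma omega_exp_le_divisors (R : numDomainType) (A m : nat) : (0 < m)%N ->
  A.+1%:R ^+ omega m <= \sum_(d <- divisors m) A%:R ^+ omega d :> R.
Proof.
elim/ltn_ind: m => m IH m0.
have [m1|m1] := leqP m 1.
  have -> : m = 1%N by apply/eqP; rewrite eqn_leq m1.
  by rewrite big_cons big_nil /omega /= !expr0 addr0.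
set q := pdiv m; have pq : prime q by rewrite pdiv_prime.
have qm : (q %| m)%N by rewrite pdiv_dvd.
set e := logn q m; set n := (m %/ q ^ e)%N.
have mE : m = (q ^ e * n)%N by rewrite mulnC divnK// pfactor_dvdnn.
have e0 : (0 < e)%N by rewrite logn_gt0 mem_primes pq m0.
have n0 : (0 < n)%N by move: m0; rewrite {1}mE muln_gt0 => /andP[].
have qn : ~~ (q %| n)%N.
  by have := pfactor_coprime pq m0 => -[k]; rewrite prime_coprime// => qk E;
     rewrite /n /e {1}E mulnK// expn_gt0 prime_gt0.
have nm : (n < m)%N.
  rewrite ltn_Pdiv// -(expn0 q) ltn_exp2l ?prime_gt1//.
rewrite {1}mE omega_primeM// exprS.
apply: (@le_trans _ _ (A.+1%:R * \sum_(d <- divisors n) A%:R ^+ omega d)).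
  by rewrite ler_wpM2l// IH.
apply: (@le_trans _ _ (\sum_(d <- divisors n ++ map (muln q) (divisors n))
     A%:R ^+ omega d)).
  rewrite big_cat big_map/= -natr1 mulrDl mul1r [leLHS]addrC lerD// mulr_sumr.
  rewrite big_seq [leRHS]big_seq; apply: ler_sum => d.
  rewrite -dvdn_divisors// => dn.
  have qd : ~~ (q %| d)%N by apply: contra qn => /dvdn_trans; apply.
  by rewrite -[X in omega (X * _)]expn1 omega_primeM// ?exprS// (dvdn_gt0 n0).
apply: ler_sum_subset => [d||d].
- by rewrite exprn_ge0.
- rewrite cat_uniq divisors_uniq map_inj_uniq ?divisors_uniq ?andbT//=; last first.
    by move=> a b /eqP; rewrite eqn_pmul2l ?prime_gt0// => /eqP.
  apply/hasPn => _ /mapP[d dn ->]; rewrite -dvdn_divisors//.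
  by apply: contra qn; apply: dvdn_trans; rewrite dvdn_mulr.
- rewrite mem_cat -!dvdn_divisors// => /orP[dn|/mapP[c]].
    by rewrite mE dvdn_mull.
  rewrite -dvdn_divisors// => cn ->; rewrite mE dvdn_mul//.
  by rewrite -{1}(expn1 q) dvdn_exp2l.
Qed.

(** Passing from [A] to [A.+1] is dominated by a Dirichlet convolution with the constant 1, which
    costs one factor [harm R M]. For [A = 0] the weight vanishes except at [m = 1]. *)
Lemma sum_omega_le (R : realType) (A M : nat) :
  \sum_(1 <= m < M.+1) A%:R ^+ omega m / m%:R <= harm R M ^+ A.
Proof.
elim: A => [|A IH].
  rewrite expr0; case: M => [|M]; first by rewrite big_geq.
  rewrite big_nat_recl// big_nat_cond big1 ?addr0 ?divr1//.
  move=> m; rewrite andbT => /andP[m0 _]; rewrite /omega.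
  case E : (primes m.+1) => [|p s]; last by rewrite /= exprS !mul0r.
  have := pdiv_prime (n := m.+1); rewrite ltnS m0 => /(_ isT) pp.
  have : pdiv m.+1 \in primes m.+1 by rewrite mem_primes pp pdiv_dvd.
  by rewrite E.
apply: (@le_trans _ _ (\sum_(1 <= m < M.+1) \sum_(d <- divisors m)
    (A%:R ^+ omega d / d%:R) * ((m %/ d)%N%:R^-1))).
  rewrite big_nat_cond [leRHS]big_nat_cond; apply: ler_sum => m.
  rewrite andbT => /andP[m0 _].
  rewrite ler_pdivrMr ?ltr0n// (le_trans (omega_exp_le_divisors _ _ _))//.
  rewrite mulr_suml big_seq [leRHS]big_seq; apply: ler_sum => d.
  rewrite -dvdn_divisors// => dm.
  have d0 : (0 < d)%N := dvdn_gt0 m0 dm.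
  have e0 : (0 < m %/ d)%N by rewrite divn_gt0// dvdn_leq.
  rewrite -{2}(divnK dm) natrM -mulrA -mulrA.
  rewrite [X in _ * X](_ : _ = 1) ?mulr1//.
  by field; rewrite !pnatr_eq0 -!lt0n d0 e0.
apply: le_trans (sum_divisors_convolution (F := fun d e =>
  (A%:R ^+ omega d / d%:R) * (e%:R^-1)) _ _) _ => [d e|].
  by rewrite !mulr_ge0 ?invr_ge0 ?exprn_ge0.
under eq_bigr do rewrite -mulr_sumr.
rewrite -mulr_suml exprSr ler_wpM2r// /harm.
by apply: sumr_ge0 => i _; rewrite invr_ge0.
Qed.

(** * Divisor sums over totients, by Rankin's trick *)

Section Sigma.
Variables (R : realType) (e : R).

(** The classical divisor function sigma of order [- e] for [n > 0]. *)
Definition sig (n : nat) : R := \sum_(d <- divisors n) d%:R `^ (- e).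

Lemma sig_ge0 n : 0 <= sig n.
Proof. by apply: sumr_ge0 => d _; rewrite powR_ge0. Qed.

Lemma sig_dvd a b : (0 < b)%N -> (a %| b)%N -> sig a <= sig b.
Proof.
move=> b0 ab; have a0 := dvdn_gt0 b0 ab.
apply: ler_sum_subset => [d||d]; rewrite ?powR_ge0 ?divisors_uniq//.
by rewrite -!dvdn_divisors// => /dvdn_trans; apply.
Qed.

(** Submultiplicativity: a divisor [d] of [a * b] is the product of [gcdn d a], which divides [a],
    and [d %/ gcdn d a], which divides [b]. *)
Lemma sigM a b : (0 < a)%N -> (0 < b)%N -> sig (a * b) <= sig a * sig b.
Proof.
move=> a0 b0; rewrite /sig mulr_suml.
under [leRHS]eq_bigr do rewrite mulr_sumr.
under [leRHS]eq_bigr do under eq_bigr do rewrite -powRM ?ler0n// -natrM.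
rewrite -(big_allpairs (F := fun p => (p.1 * p.2)%:R `^ (- e)))/=.
rewrite -(big_map (fun p => p.1 * p.2)%N xpredT (fun d => d%:R `^ (- e))).
apply: ler_sum_subset => [d||d]; rewrite ?powR_ge0 ?divisors_uniq//.
rewrite -dvdn_divisors ?muln_gt0 ?a0// => dab.
have d0 : (0 < d)%N by rewrite (dvdn_gt0 _ dab)// muln_gt0 a0.
apply/mapP; exists (gcdn d a, d %/ gcdn d a)%N => /=; last first.
  by rewrite mulnC divnK// dvdn_gcdl.
apply/allpairsP; exists (gcdn d a, d %/ gcdn d a)%N => /=; split=> //.
  by rewrite -dvdn_divisors// dvdn_gcdr.
rewrite -dvdn_divisors// dvdn_divLR ?dvdn_gcdl// ?gcdn_gt0 ?d0//.
by rewrite muln_gcdr dvdn_gcd dvdn_mull// mulnC.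
Qed.

Hypothesis e0 : 0 < e.

Lemma powRN_le1 d : (0 < d)%N -> d%:R `^ (- e) <= 1 :> R.
Proof.
move=> d0; rewrite -[leRHS](powRr0 d%:R) ler_powR// ?ler1n// oppr_le0.
exact: ltW.
Qed.

Lemma sig_prime q : prime q -> sig q <= 2.
Proof.
move=> pq; apply: (@le_trans _ _ (\sum_(d <- [:: 1; q]%N) d%:R `^ (- e))).
  apply: ler_sum_subset => [d||d]; rewrite ?powR_ge0 ?divisors_uniq//.
  rewrite -dvdn_divisors ?prime_gt0// => dq.
  by rewrite !inE; case/primeP: pq => _; apply.
by rewrite big_cons big_seq1 lerD// powRN_le1// prime_gt0.
Qed.

Variables (t : R) (t0 : 0 < t) (M : nat).

Let w (m : nat) : R := m%:R `^ (- (1 + t)).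

Let w0 m : 0 <= w m. Proof. exact: powR_ge0. Qed.
Let wM a b : w (a * b) = w a * w b. Proof. by rewrite /w natrM powRM. Qed.

(** Writing [m = d * k] splits the sum into truncated zeta sums at [1 + t + e] and [1 + t]; the
    first is bounded by the one at [1 + e]. *)
Lemma sum_sig_le : \sum_(1 <= m < M.+1) sig m * w m <= (1 + e^-1) * (1 + t^-1).
Proof.
apply: (@le_trans _ _ (\sum_(1 <= m < M.+1) \sum_(d <- divisors m)
    (d%:R `^ (- e) * w d) * w (m %/ d))).
  rewrite big_nat_cond [leRHS]big_nat_cond; apply: ler_sum => m.
  rewrite andbT => /andP[m0 _]; rewrite mulr_suml.
  rewrite big_seq [leRHS]big_seq; apply: ler_sum => d.
  by rewrite -dvdn_divisors// => dm; rewrite -mulrA -wM mulnC divnK.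
apply: le_trans (sum_divisors_convolution (F := fun d k =>
  (d%:R `^ (- e) * w d) * w k) _ _) _ => [d k|].
  by rewrite !mulr_ge0 ?powR_ge0.
under eq_bigr do rewrite -mulr_sumr.
rewrite -mulr_suml ler_pM ?zsum_le ?zsum_ge0//.
  by apply: sumr_ge0 => d _; rewrite mulr_ge0 ?powR_ge0.
apply: le_trans (zsum_le M e0); rewrite /zsum.
rewrite big_nat_cond [leRHS]big_nat_cond; apply: ler_sum => m.
rewrite andbT => /andP[m0 _].
rewrite /w -powRD; last by rewrite pnatr_eq0 -lt0n m0 implybT.
by rewrite ler_powR ?ler1n//; move: t0 e0; lra.
Qed.

(* [m * \prod_(q | m) (q - 1)], the product restricted to the primes [q <= y]:
   a multiple of [totient m] once [m <= y]. *)
Definition tot_multiple (y m : nat) : nat :=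
  m * \prod_(1 <= q < y.+1 | prime q && (q %| m)%N) q.-1.

Lemma tot_multiple_gt0 y m : (0 < m)%N -> (0 < tot_multiple y m)%N.
Proof.
move=> m0; rewrite muln_gt0 m0 prodn_cond_gt0// => q /andP[/prime_gt1 q1 _].
by rewrite -subn1 subn_gt0.
Qed.

Lemma totient_dvd_tot_multiple y m : (0 < m <= y)%N ->
  (totient m %| tot_multiple y m)%N.
Proof.
move=> /andP[m0 my]; rewrite totientE// big_split/= mulnC dvdn_mul//.
  rewrite [X in (_ %| X)%N](prod_primes m0).
  by elim/big_ind2: _ => // [*|q _]; rewrite ?dvdn_mul// dvdn_exp2l// leq_pred.
rewrite -[X in (_ %| X)%N]big_filter [X in (_ %| X)%N](perm_big (primes m))//=.
apply: uniq_perm; rewrite ?filter_uniq ?iota_uniq ?primes_uniq// => q.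
rewrite mem_filter mem_index_iota mem_primes m0/=.
case: (boolP (prime q)) => //= pq; case: (boolP (q %| m)%N) => //= qm.
by rewrite prime_gt0//= ltnS (leq_trans _ my)// dvdn_leq.
Qed.

Lemma tot_multipleS y m : tot_multiple y.+1 m =
  (tot_multiple y m * (if prime y.+1 && (y.+1 %| m)%N then y else 1))%N.
Proof. by rewrite /tot_multiple big_mkcond big_nat_recr//= -big_mkcond mulnA. Qed.

Lemma tot_multiple_prime y m : prime y.+1 ->
  tot_multiple y (y.+1 * m) = (y.+1 * tot_multiple y m)%N.
Proof.
move=> py; rewrite /tot_multiple mulnA; congr (_ * _)%N.
rewrite big_nat_cond [RHS]big_nat_cond; apply: eq_bigl => q.
case: (boolP (0 < q < y.+1)%N) => //= /andP[q0 qy].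
case: (boolP (prime q)) => //= pq; rewrite Euclid_dvdM// dvdn_prime2//.
by rewrite ltn_eqF.
Qed.

Let Z y := \sum_(1 <= m < M.+1) sig (tot_multiple y m) * w m.

Let Z_ge0 y : 0 <= Z y.
Proof. by apply: sumr_ge0 => m _; rewrite mulr_ge0 ?sig_ge0. Qed.

(** Only a prime [y.+1] changes anything, and only at its multiples, where the argument of [sig]
    gains a factor [y]. Substituting [y.+1 * m] for [m] then costs [w y.+1] and [sig y.+1 <= 2]. *)
Lemma Z_step y : Z y.+1 <= Z y * (1 + 2 * (sig y * w y.+1)).
Proof.
have [py|py] := boolP (prime y.+1); last first.
  apply: (@le_trans _ _ (Z y)).
    by apply: ler_sum => m _; rewrite tot_multipleS (negbTE py) muln1.
  by rewrite ler_peMr// lerDl !mulr_ge0 ?sig_ge0.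
have y0 : (0 < y)%N by rewrite -ltnS prime_gt1.
apply: (@le_trans _ _ (Z y + sig y * \sum_(1 <= m < M.+1 | (y.+1 %| m)%N)
   sig (tot_multiple y m) * w m)).
  rewrite mulr_sumr [X in _ + X]big_mkcond/= /Z -big_split/=.
  rewrite big_nat_cond [leRHS]big_nat_cond; apply: ler_sum => m.
  rewrite andbT => /andP[m0 _]; rewrite tot_multipleS py/=.
  case: ifP => ym; last by rewrite muln1 addr0.
  rewrite mulrA -[leLHS]add0r lerD ?mulr_ge0 ?sig_ge0//.
  by rewrite ler_wpM2r// mulnC sigM// tot_multiple_gt0.
rewrite mulrDr mulr1 lerD2l.
apply: (@le_trans _ _ (sig y * \sum_(1 <= m < M.+1)
   sig (tot_multiple y (y.+1 * m)) * w (y.+1 * m))).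
  rewrite ler_wpM2l ?sig_ge0//.
  apply: (sum_multiples_le (F := fun m => sig (tot_multiple y m) * w m)) => // m.
  by rewrite mulr_ge0 ?sig_ge0.
rewrite [leRHS](_ : _ = sig y * (\sum_(1 <= m < M.+1)
   2 * sig (tot_multiple y m) * (w y.+1 * w m))); last first.
  by rewrite /Z mulr_suml mulr_sumr; apply: eq_bigr => m _; ring.
rewrite ler_wpM2l ?sig_ge0// big_nat_cond [leRHS]big_nat_cond; apply: ler_sum => m.
rewrite andbT => /andP[m0 _]; rewrite wM ler_wpM2r ?mulr_ge0//.
rewrite tot_multiple_prime// (le_trans (sigM _ _))// ?tot_multiple_gt0//.
by rewrite ler_wpM2r ?sig_ge0// sig_prime.
Qed.

(** The factors [1 + u] become exponentials. The sum in the exponent runs over all integers, not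
    just primes, and still converges thanks to [e > 0]. *)
Lemma Z_le y : Z y <= Z 0 * expR (2 * \sum_(0 <= i < y) sig i * w i.+1).
Proof.
elim: y => [|y IH]; first by rewrite big_geq// mulr0 expR0 mulr1.
rewrite (le_trans (Z_step y))// big_nat_recr//= [X in expR X]mulrDr expRD mulrA.
by rewrite mulrA ler_pM ?expR_ge1Dx// addr_ge0// !mulr_ge0 ?sig_ge0.
Qed.

(** Rankin: [1 / m <= M^t * w m] for [m <= M], and [totient m] divides [tot_multiple M m]. Both
    [Z 0] and the exponent of [Z_le] are then controlled by [sum_sig_le]. *)
Lemma sum_sig_totient_le : forall B, B = (1 + e^-1) * (1 + t^-1) ->
  \sum_(1 <= m < M.+1) sig (totient m) / m%:R <= M%:R `^ t * (B * expR (2 * (1 + B))).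
Proof.
move=> B BE; have Z0 : Z 0 = \sum_(1 <= m < M.+1) sig m * w m.
  by apply: eq_bigr => m _; rewrite /tot_multiple big_geq// muln1.
apply: (@le_trans _ _ (M%:R `^ t * Z M)).
  rewrite /Z mulr_sumr big_nat_cond [leRHS]big_nat_cond; apply: ler_sum => m.
  rewrite andbT => /andP[m0 mM]; rewrite mulrCA.
  rewrite ler_pM ?sig_ge0 ?invr_ge0//.
    by rewrite sig_dvd ?tot_multiple_gt0// totient_dvd_tot_multiple// m0.
  apply: (@le_trans _ _ (m%:R `^ t * w m)).
    rewrite -powRD; last by rewrite pnatr_eq0 -lt0n m0 implybT.
    by rewrite opprD addrCA subrr addr0 powR_inv1.
  rewrite ler_wpM2r// ge0_ler_powR ?nnegrE ?ler_nat//; exact: ltW.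
rewrite ler_wpM2l ?powR_ge0// (le_trans (Z_le M))//.
have ZB : Z 0 <= B by rewrite Z0 BE sum_sig_le.
rewrite ler_pM ?expR_ge0// ler_expR ler_wpM2l//.
(* [divisors 0] is [[:: 1]], so the term at 0 equals 1; the others are compared through
   [w i.+1 <= w i]. *)
apply: le_trans (_ : _ <= 1 + Z 0) _; last by rewrite lerD2l.
rewrite Z0; case: M => [|n]; first by rewrite !big_geq// addr0 ler01.
rewrite big_nat_recl// lerD//.
  by rewrite /sig big_seq1 /w !powR1 mulr1.
rewrite [leRHS]big_add1/= big_nat_recr//= -[leLHS]addr0 lerD ?mulr_ge0 ?sig_ge0//.
apply: ler_sum => i _; rewrite ler_wpM2l ?sig_ge0// /w !powRN lef_pV2 ?posrE ?powR_gt0//.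
by rewrite ge0_ler_powR ?nnegrE ?ler_nat// addr_ge0// ltW.
Qed.
End Sigma.

(** * Union bounds and counting in residue classes *)

Lemma count_le_add (T : eqType) (P Q Q' : pred T) (t : seq T) :
  (forall v, v \in t -> P v -> Q v || Q' v) ->
  (count P t <= count Q t + count Q' t)%N.
Proof.
move=> PQ; rewrite -count_predUI (leq_trans _ (leq_addr _ _))//.
elim: t PQ => //= x t IH PQ; rewrite leq_add//.
  by case: (boolP (P x)) => // Px; rewrite PQ// mem_head.
by apply: IH => v vt; apply: PQ; rewrite inE vt orbT.
Qed.

Lemma count_cover (I T : eqType) (r : seq I) (c : pred I) (t : seq T)
    (P : pred T) (Q : I -> pred T) :
  (forall v, v \in t -> P v -> exists i, [/\ i \in r, c i & Q i v]) ->
  (count P t <= \sum_(i <- r | c i) count (Q i) t)%N.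
Proof.
elim: t => [|x t IH] PQ; first by rewrite leq0n.
rewrite /= big_split/= leq_add//; last first.
  by apply: IH => v vt; apply: PQ; rewrite inE vt orbT.
case: (boolP (P x)) => // /(PQ _ (mem_head _ _))[i [ir ci Qi]].
by rewrite (big_rem i ir)/= ci Qi.
Qed.

(** The counted numbers share one residue modulo [D], so [v %/ D] is injective on them, with values
    from 0 to [M %/ D]. *)
Lemma count_congruent (P : pred nat) (D M : nat) : (0 < D)%N ->
  (forall v w, (0 < v)%N -> (v < w <= M)%N -> P v -> P w -> (D %| w - v)%N) ->
  (count P (index_iota 1 M.+1) <= M %/ D + 1)%N.
Proof.
move=> D0 PD; rewrite -size_filter; set t := [seq v <- _ | P v].
have tP v : v \in t -> [/\ P v, (0 < v)%N & (v <= M)%N].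
  by rewrite mem_filter mem_index_iota ltnS => /andP[Pv /andP[v0 vM]].
rewrite -(size_map (divn^~ D)) addn1 -(size_iota 0 (M %/ D).+1).
apply: uniq_leq_size.
  rewrite map_inj_in_uniq ?filter_uniq ?iota_uniq// => v w.
  wlog : v w / (v < w)%N.
    move=> H vt wt E; have [vw|wv|//] := ltngtP v w; first exact: H.
    by apply/esym/H.
  move=> vw /tP[Pv v0 _] /tP[Pw _ wM] E.
  have := PD v w v0; rewrite vw wM => /(_ isT Pv Pw).
  rewrite -eqn_mod_dvd ?(ltnW vw)// => /eqP mE.
  by rewrite (divn_eq v D) (divn_eq w D) E mE.
move=> _ /mapP[v /tP[_ _ vM] ->].
by rewrite mem_iota/= add0n ltnS leq_div2r.
Qed.

Lemma count_dvd (D M : nat) : (0 < D)%N ->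
  (count (dvdn D) (index_iota 1 M.+1) <= M %/ D)%N.
Proof.
move=> D0; rewrite -size_filter -(size_map (divn^~ D)) -(size_iota 1 (M %/ D)).
apply: uniq_leq_size.
  rewrite map_inj_in_uniq ?filter_uniq ?iota_uniq// => v w.
  rewrite !mem_filter => /andP[Dv _] /andP[Dw _] E.
  by rewrite -(divnK Dv) E divnK.
move=> x /mapP[v]; rewrite mem_filter mem_index_iota => /andP[Dv /andP[v0 vM]] ->.
by rewrite mem_iota add1n ltnS leq_div2r// divn_gt0// dvdn_leq.
Qed.

Lemma count_mul_le (D M : nat) : (0 < D)%N ->
  (count (fun v => v * D <= M)%N (index_iota 1 M.+1) <= M %/ D)%N.
Proof.
move=> D0; rewrite -size_filter -(size_iota 1 (M %/ D)).
apply: uniq_leq_size; first by rewrite filter_uniq ?iota_uniq.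
move=> v; rewrite mem_filter mem_index_iota => /andP[Dv /andP[v0 vM]].
by rewrite mem_iota add1n ltnS v0 leq_divRL.
Qed.

Lemma natr_divn_le (R : realFieldType) (M D : nat) :
  (M %/ D)%N%:R <= M%:R / D%:R :> R.
Proof.
have [->|D0] := posnP D; first by rewrite divn0 mulr_ge0 ?invr_ge0.
by rewrite ler_pdivlMr ?ltr0n// -natrM ler_nat leq_divM.
Qed.

(** * Integers with no large prime factor of multiplicity one *)

Definition has_large_simple_prime (s v : nat) : bool :=
  has (fun p => (s ^ 2 < p)%N && ~~ (p ^ 2 %| v)%N) (primes v).

(** Take for [d ^ 2] the largest square divisor. If [d < s], a prime [q > s ^ 2] of [v] would have
    [q ^ 2] dividing [v], hence [q <= d], which is absurd; so all primes of [v] are at most [s ^ 2],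
    and [v] is at most [d ^ 2] times their product. *)
Lemma no_large_simple_prime (s v : nat) : (0 < s)%N -> (0 < v)%N ->
  ~~ has_large_simple_prime s v ->
  exists2 d, (d ^ 2 %| v)%N & (s <= d)%N || (v <= s ^ (2 * omega v + 2))%N.
Proof.
move=> s0 v0 /hasPn nl; pose d := (\prod_(q <- primes v) q ^ (logn q v)./2)%N.
exists d.
  rewrite /d expnE /= [X in (_ %| X)%N](prod_primes v0) -big_split/=.
  elim/big_ind2: _ => // [*|q _]; first exact: dvdn_mul.
  by rewrite -expnD addnn dvdn_exp2l// -[leqRHS]odd_double_half leq_addl.
have [//|ds] := leqP s d.
rewrite /= addnC expnD; apply: (@leq_trans (d ^ 2 * s ^ (2 * omega v))).
  rewrite {1}(prod_primes v0) expnM /omega.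
  have -> : ((s ^ 2) ^ size (primes v))%N = (\prod_(q <- primes v) s ^ 2)%N.
    by rewrite big_const_seq count_predT iter_muln_1.
  rewrite /d -mulnn -!big_split/= !big_seq.
  apply: leq_prod => q; rewrite mem_primes => /and3P[pq _ qv].
  have q0 := prime_gt0 pq.
  apply: (@leq_trans (q ^ (logn q v)./2 * q ^ (logn q v)./2 * q))%N.
    rewrite -expnD addnn -expnSr leq_exp2l ?prime_gt1//.
    by rewrite -{1}[logn q v]odd_double_half -add1n leq_add2r leq_b1.
  rewrite leq_pmul2l ?muln_gt0 ?expn_gt0 ?q0// leqNgt; apply/negP => qs.
  have := nl q; rewrite mem_primes pq v0 qv => /(_ isT).
  rewrite qs/= negbK pfactor_dvdn// => e2.
  have : (q <= d)%N.
    apply: dvdn_leq; first rewrite /d big_seq prodn_cond_gt0// => r.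
      by rewrite mem_primes expn_gt0 => /and3P[/prime_gt0 ->].
    rewrite /d (big_rem q) ?mem_primes ?pq ?v0//= dvdn_mulr//.
    by rewrite -{1}(expn1 q) dvdn_exp2l// half_gt0.
  move/(leq_ltn_trans)/(_ ds); apply/negP; rewrite -leqNgt (leq_trans _ (ltnW qs))//.
  by rewrite -{1}(expn1 s) leq_pexp2l.
by rewrite leq_mul2r leq_exp2r// (ltnW ds) orbT.
Qed.

Lemma count_no_large_simple_prime (R : realType) (s k A M : nat) :
  (0 < s)%N -> (0 < A)%N -> (s ^ (2 * k + 3) <= M)%N ->
  (count (fun v => ~~ has_large_simple_prime s v) (index_iota 1 M.+1))%:R <=
  3 * M%:R / s%:R + M%:R * harm R M ^+ A / A%:R ^+ k.
Proof.
move=> s0 A0 sM; set t := index_iota 1 M.+1.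
have C : (count (fun v => ~~ has_large_simple_prime s v) t <=
   \sum_(d <- index_iota s M.+1) count (dvdn (d ^ 2)) t +
   (M %/ s + count (fun v => k <= omega v)%N t))%N.
  pose Q (v : nat) := has (fun d => d ^ 2 %| v)%N (index_iota s M.+1).
  apply: (@leq_trans (count Q t + (count (fun v => v * s <= M)%N t +
      count (fun v => k <= omega v)%N t))%N); last first.
    rewrite leq_add ?leq_add2r ?count_mul_le//.
    apply: count_cover => v _ /hasP[d dM dv]; by exists d.
  apply: leq_trans (count_le_add _ (Q := Q)
    (Q' := fun v => (v * s <= M)%N || (k <= omega v)%N)) _.
    move=> v; rewrite mem_index_iota ltnS => /andP[v0 vM].
    move=> /(no_large_simple_prime s0 v0)[d dv] /orP[sd|vs].
      apply/orP; left; apply/hasP; exists d => //.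
      rewrite mem_index_iota sd ltnS (leq_trans _ vM)//.
      rewrite (leq_trans _ (dvdn_leq v0 dv))// -{1}(expn1 d) leq_pexp2l//.
      exact: leq_trans sd.
    (* If [v * s <= M] fails, then [s ^ (2 * k + 3) <= M < v * s <= s ^ (2 * omega v + 3)], whence
       [k <= omega v]. *)
    apply/orP; right; rewrite -implyNb -ltnNge; apply/implyP => Mvs.
    have s1 : (1 < s)%N.
      rewrite ltnNge; apply/negP => s1; have E : s = 1%N by apply/eqP; rewrite eqn_leq s1.
      by move: Mvs; rewrite E muln1 ltnNge vM.
    have : (s ^ (2 * k + 3) < s ^ (2 * omega v + 3))%N.
      rewrite (leq_ltn_trans sM)// (leq_trans Mvs)// addnS expnSr leq_mul2r.
      by rewrite vs orbT.
    by rewrite ltn_exp2l// ltn_add2r ltn_pmul2l// => /ltnW.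
  by rewrite leq_add2l count_le_add// => v _ /orP[] ->; rewrite ?orbT.
have M0 : 0 <= M%:R :> R by [].
have s0' : 0 < s%:R :> R by rewrite ltr0n.
apply: (@le_trans _ _ _ _ _ (_ : _ <= _%:R)); first by rewrite ler_nat; exact: C.
rewrite !natrD natr_sum.
have -> : 3 * M%:R / s%:R = M%:R * (2 / s%:R) + M%:R / s%:R :> R by ring.
rewrite -[leRHS]addrA lerD//.
  apply: (@le_trans _ _ (\sum_(s <= d < M.+1) M%:R * (d%:R ^- 2 : R))).
    rewrite big_nat_cond [leRHS]big_nat_cond; apply: ler_sum => d.
    rewrite andbT => /andP[sd _]; have d0 : (0 < d)%N by exact: leq_trans sd.
    apply: (@le_trans _ _ (M %/ d ^ 2)%N%:R).
      by rewrite ler_nat count_dvd// expn_gt0 d0.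
    by rewrite (le_trans (natr_divn_le _ _ _))// natrX.
  by rewrite -mulr_sumr ler_wpM2l// sum_inv_square_le.
rewrite lerD ?natr_divn_le//.
have Ak : 0 < A%:R ^+ k :> R by rewrite exprn_gt0// ltr0n.
rewrite -mulrA -sum1_count natr_sum big_mkcond/=.
(* The indicator of [k <= omega v] is majorised by the product of [M / v >= 1] and
   [A ^ (omega v - k) >= 1]. *)
apply: (@le_trans _ _ (\sum_(1 <= v < M.+1) M%:R * ((A%:R ^+ omega v / v%:R) / A%:R ^+ k))).
  rewrite big_nat_cond [leRHS]big_nat_cond; apply: ler_sum => v.
  rewrite andbT => /andP[v0 vM].
  have v0' : 0 < v%:R :> R by rewrite ltr0n.
  case: ifP => kv; last by rewrite !mulr_ge0 ?invr_ge0 ?exprn_ge0.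
  rewrite mulrA ler_pdivlMr// mul1r mulrCA -[leLHS]mulr1 ler_pM//.
    by apply: ler_weXn2l => //; rewrite ler1n.
  by rewrite ler_pdivlMr// mul1r ler_nat.
by rewrite -mulr_sumr -mulr_suml ler_wpM2l// ler_wpM2r ?invr_ge0 ?(ltW Ak)// sum_omega_le.
Qed.

(** * Coincidences in which both neighbours have a large simple prime *)

(* [f] is the predecessor or the successor, so that [{f v, v}] is a pair of
   consecutive integers; the larger of the two primes divides [v]. *)
Section Solutions.
Variable f : nat -> nat.
Hypothesis f_shift : forall v w, (0 < v)%N -> (0 < w)%N -> (f v + w = f w + v)%N.
Hypothesis f_le : forall v, (0 < v)%N -> (f v <= v.+1)%N.
Hypothesis f_ge : forall v, (0 < v)%N -> (v <= (f v).+1)%N.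
Hypothesis f_coprime : forall v, (0 < v)%N -> coprime (f v) v.

(** The size condition is stated for the smaller prime [p]; the larger prime [p'] inherits it. *)
Record solution (s v p p' m m' : nat) : Prop := Solution {
  sol_p : prime p;
  sol_p' : prime p';
  sol_large : (s ^ 2 < p)%N;
  sol_lt : (p < p')%N;
  sol_fv : f v = (m * p)%N;
  sol_v : v = (m' * p')%N;
  sol_m : ~~ (p %| m)%N;
  sol_m' : ~~ (p' %| m')%N;
  sol_tot : totient (f v) = totient v }.

Definition has_solution (s v : nat) : bool :=
  `[< exists p p' m m', solution s v p p' m m' >].

Lemma solution_totient s v p p' m m' : solution s v p p' m m' ->
  (totient m * p.-1 = totient m' * p'.-1)%N.
Proof.
case=> pp pp' _ _ fv vE pm pm' E; move: E; rewrite fv vE.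
have cm : coprime m p by rewrite coprime_sym prime_coprime.
have cm' : coprime m' p' by rewrite coprime_sym prime_coprime.
by rewrite (totient_coprime cm) (totient_coprime cm') (totient_prime pp) (totient_prime pp').
Qed.

Lemma solution_m_gt0 s v p p' m m' : solution s v p p' m m' -> (0 < m)%N.
Proof. by move=> sv; have := sol_m sv; case: m sv => //; rewrite dvdn0. Qed.

Lemma solution_m'_gt0 s v p p' m m' : solution s v p p' m m' -> (0 < m')%N.
Proof. by move=> sv; have := sol_m' sv; case: m' sv => //; rewrite dvdn0. Qed.

(** If [m < m'], then [v >= (m + 1) * (p + 1) > m * p + 1 = f v + 1], too far for neighbours. *)
Lemma solution_le s v p p' m m' : (0 < v)%N -> solution s v p p' m m' -> (m' <= m)%N.
Proof.
move=> v0 [pp pp' _ pp'lt fv vE _ _ _]; have := f_ge v0; rewrite fv vE => h.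
rewrite leqNgt; apply/negP => mm'.
have : (m.+1 * p.+1 <= m' * p')%N by rewrite leq_mul.
have := prime_gt1 pp; nia.
Qed.

Lemma solution_coprime s v p p' m m' : (0 < v)%N -> solution s v p p' m m' ->
  [/\ coprime m m', coprime p m' & coprime p p'].
Proof.
move=> v0 [pp pp' _ pp'lt fv vE _ _ _]; have := f_coprime v0; rewrite fv vE.
by rewrite coprimeMl !coprimeMr => /andP[/andP[-> _] /andP[-> ->]].
Qed.

Lemma f_dvd_sub p v w : (0 < v)%N -> (v < w)%N -> (p %| f v)%N -> (p %| f w)%N ->
  (p %| w - v)%N.
Proof.
move=> v0 vw pv pw; have w0 : (0 < w)%N by exact: leq_ltn_trans vw.
have -> : (w - v = f w - f v)%N by have := f_shift v0 w0; lia.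
exact: dvdn_sub.
Qed.

Lemma totient_lt n : (1 < n)%N -> (totient n < n)%N.
Proof.
rewrite totient_count_coprime => n1.
rewrite big_ltn ?(ltnW n1)// /coprime gcdn0 gtn_eqF// add0n.
apply: (@leq_ltn_trans (\sum_(1 <= d < n) 1)); first by apply: leq_sum => d _; exact: leq_b1.
by rewrite sum_nat_const_nat muln1 subn1 prednK// ltnW.
Qed.

(* Two solutions would make the linear system for [(p, p')] singular, i.e.
   [m * totient m' = m' * totient m], which forces [m = m' = 1]. *)
Lemma solution_unique s v w p p' q q' m m' : (0 < v)%N -> (0 < w)%N ->
  solution s v p p' m m' -> solution s w q q' m m' -> v = w.
Proof.
move=> v0 w0 sv sw.
have m0 := solution_m_gt0 sv; have m'0 := solution_m'_gt0 sv.
have [cm _ _] := solution_coprime v0 sv.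
have tv := solution_totient sv; have tw := solution_totient sw.
have E := f_shift v0 w0.
case: sv => pp pp' _ pltp' fv vE _ _ _; case: sw => pq pq' _ qltq' fw wE _ _ _.
have p1 := prime_gt1 pp; have p'1 := prime_gt1 pp'.
have q1 := prime_gt1 pq; have q'1 := prime_gt1 pq'.
have [pqE|npq] := eqVneq p q.
  by move: E; rewrite fv fw pqE => /eqP; rewrite eqn_add2l => /eqP.
have key : (m * totient m' = m' * totient m)%N.
  have E' : (m * p + m' * q' = m * q + m' * p')%N by rewrite -fv -fw -vE -wE.
  move: npq E' tv tw; rewrite -(prednK (ltnW p1)) -(prednK (ltnW p'1)).
  rewrite -(prednK (ltnW q1)) -(prednK (ltnW q'1)) /=.
  move: p.-1 p'.-1 q.-1 q'.-1 => a a' b b' ab h1 h2 h3.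
  have h : (m * totient m' * a + m' * totient m * b =
            m * totient m' * b + m' * totient m * a)%N.
    have h2' : (m' * (totient m * a) = m' * (totient m' * a'))%N by rewrite h2.
    have h3' : (m' * (totient m * b) = m' * (totient m' * b'))%N by rewrite h3.
    have h1' : (totient m' * (m * a + m' * b') = totient m' * (m * b + m' * a'))%N.
      by congr (_ * _)%N; lia.
    lia.
  have ab' : a != b by apply: contraNneq ab => ->.
  move: h ab'; move: (m * totient m')%N (m' * totient m)%N => X Y h.
  case: ltngtP => // /subnKC E' _; move: h; rewrite -E'.
    move: (b - a.+1)%N => c; nia.
  move: (a - b.+1)%N => c; nia.
(* Coprimality makes [n] divide [totient n], which is smaller than [n] unless [n = 1]. *)
have d1 n k : (0 < n)%N -> coprime n k -> (n * totient k = k * totient n)%N -> n = 1%N.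
  move=> n0 cnk nk; apply/eqP; rewrite eqn_leq n0 andbT leqNgt; apply/negP => n1.
  have : (n %| totient n)%N by rewrite -(Gauss_dvdr _ cnk) -nk dvdn_mulr.
  move=> /dvdn_leq; rewrite totient_gt0 n0 => /(_ isT).
  by apply/negP; rewrite -ltnNge totient_lt.
have mE := d1 _ _ m0 cm key.
have m'E := d1 m' m m'0 (etrans (coprime_sym _ _) cm) (esym key).
have t1 : totient 1 = 1%N by [].
move: tv; rewrite mE m'E t1 !mul1n; lia.
Qed.

Lemma sumr1_count (R : pzSemiRingType) (I : Type) (r : seq I) (P : pred I) :
  \sum_(i <- r | P i) (1 : R) = (count P r)%:R.
Proof. by rewrite -sum1_count natr_sum. Qed.

(** * Counting solutions: small gcd, small cofactors, large gcd *)

Section Bound.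
Variables (R : realType) (s M : nat).
Hypothesis s0 : (0 < s)%N.
Let t := index_iota 1 M.+1.

Definition sol_near (v : nat) : bool := `[< exists p p' m m',
  solution s v p p' m m' /\ (gcdn p.-1 p'.-1 * s <= p')%N >].
Definition sol_small (v : nat) : bool := `[< exists p p' m m',
  solution s v p p' m m' /\ (m <= s ^ 2)%N >].
Definition sol_far (v : nat) : bool := `[< exists p p' m m',
  [/\ solution s v p p' m m', (s ^ 2 < m)%N & (p' < gcdn p.-1 p'.-1 * s)%N ] >].

Lemma count_solution_split : (count (has_solution s) t <=
  count sol_near t + (count sol_small t + count sol_far t))%N.
Proof.
apply: leq_trans (count_le_add _ (Q := sol_near)
   (Q' := fun v => sol_small v || sol_far v)) _; last first.
  by rewrite leq_add2l count_le_add.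
move=> v _ /asboolP[p [p' [m [m' sv]]]].
have [h1|h1] := leqP (gcdn p.-1 p'.-1 * s) p'.
  by apply/orP; left; apply/asboolP; exists p, p', m, m'.
apply/orP; right; have [h2|h2] := leqP m (s ^ 2).
  by apply/orP; left; apply/asboolP; exists p, p', m, m'.
by apply/orP; right; apply/asboolP; exists p, p', m, m'.
Qed.

(** Since [m' <= m <= s ^ 2], there are at most [s ^ 4] pairs [(m, m')], each belonging to at most
    one [v]. *)
Lemma count_sol_small : (count sol_small t <= s ^ 4)%N.
Proof.
pose Q (m m' v : nat) := `[< exists p p', solution s v p p' m m' >].
apply: (@leq_trans (\sum_(m <- index_iota 1 (s ^ 2).+1) \sum_(m' <- index_iota 1 (s ^ 2).+1)
    count (Q m m') t)).
  apply: leq_trans (count_cover (r := index_iota 1 (s ^ 2).+1) (c := xpredT)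
    (Q := fun m v => `[< exists2 m', m' \in index_iota 1 (s ^ 2).+1 & Q m m' v >]) _) _.
    move=> v; rewrite mem_index_iota => /andP[v0 _] /asboolP[p [p' [m [m' [sv ms]]]]].
    exists m; split=> //.
      by rewrite mem_index_iota (solution_m_gt0 sv).
    apply/asboolP; exists m'; last by apply/asboolP; exists p, p'.
    rewrite mem_index_iota (solution_m'_gt0 sv)/= ltnS.
    exact: leq_trans (solution_le v0 sv) ms.
  apply: leq_sum => m _; apply: count_cover => v _ /asboolP[m' mm' Qv].
  by exists m'.
rewrite -[leqRHS](_ : \sum_(1 <= m < (s ^ 2).+1) \sum_(1 <= m' < (s ^ 2).+1) 1 = _)%N; last first.
  by rewrite !sum_nat_const_nat subn1 /= muln1 -expnD.
apply: leq_sum => m _; apply: leq_sum => m' _.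
(* The modulus [M.+1] exceeds the range, so the congruence count says at most one. *)
apply: leq_trans (count_congruent (D := M.+1) _ _) _ => //; last by rewrite divn_small.
move=> v w v0 /andP[vw wM] /asboolP[p [p' sv]] /asboolP[q [q' sw]].
have w0 : (0 < w)%N by exact: leq_ltn_trans vw.
by move: vw; rewrite (solution_unique v0 w0 sv sw) ltnn.
Qed.

(** Cancelling [g] in the totient equation leaves [totient m * a = totient m' * a'], and [a] is
    coprime to [a']. *)
Lemma solution_gcd v p p' m m' : (0 < v)%N -> solution s v p p' m m' ->
  let g := gcdn p.-1 p'.-1 in exists a a',
  [/\ (0 < g)%N, p = (a * g).+1, p' = (a' * g).+1, coprime a a' &
      (a %| totient m')%N].
Proof.
move=> v0 sv g; have tv := solution_totient sv.
case: sv => pp pp' _ pltp' _ _ _ _ _.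
have p1 := prime_gt1 pp; have p'1 := prime_gt1 pp'.
have g0 : (0 < g)%N by rewrite gcdn_gt0 -subn1 subn_gt0 p1.
have pE : p.-1 = (p.-1 %/ g * g)%N by rewrite divnK// dvdn_gcdl.
have p'E : p'.-1 = (p'.-1 %/ g * g)%N by rewrite divnK// dvdn_gcdr.
exists (p.-1 %/ g)%N, (p'.-1 %/ g)%N; split => //.
- by rewrite -pE prednK// ltnW.
- by rewrite -p'E prednK// ltnW.
- rewrite /coprime -(eqn_pmul2r g0) muln_gcdl -pE -p'E mul1n//.
- have c : coprime (p.-1 %/ g) (p'.-1 %/ g).
    by rewrite /coprime -(eqn_pmul2r g0) muln_gcdl -pE -p'E mul1n.
  rewrite -(Gauss_dvdl _ c); apply/dvdnP; exists (totient m).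
  apply/eqP; rewrite -(eqn_pmul2r g0) -!mulnA -pE -p'E; apply/eqP.
  by rewrite -tv mulnC.
Qed.

(** The congruences left after forgetting primality: [v %/ m'] stands for [p'] and [(a * g).+1] for
    [p]. *)
Definition near_class (m' a g v : nat) : bool :=
  [&& (m' %| v)%N, (g %| (v %/ m').-1)%N, ((a * g).+1 %| f v)%N &
      coprime (a * g).+1 m'].

(** The size constraints come from [g * s <= p'] and [a * g < p'], with [m' * p' = v <= M], and from
    [s ^ 2 < p]. *)
Definition near_cond (m' a g : nat) : bool :=
  [&& g * (m' * s) <= M, g * (m' * a) <= M & s ^ 2 <= a * g]%N.

(** [v] is fixed modulo [m' * g] and modulo [(a * g).+1], and these moduli are coprime. *)
Lemma count_near_class m' a g : (0 < m')%N -> (0 < g)%N ->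
  (count (near_class m' a g) t <= M %/ (m' * g * (a * g).+1) + 1)%N.
Proof.
move=> m'0 g0; apply: count_congruent; first by rewrite !muln_gt0 m'0 g0.
move=> v w v0 /andP[vw wM] /and4P[mv gv pv cp] /and4P[mw gw pw _].
rewrite Gauss_dvd; last first.
  rewrite coprime_sym coprimeMr cp/= coprime_sym /coprime -addn1 gcdnMDl gcdn1//.
rewrite [X in _ && X](f_dvd_sub v0 vw pv pw) andbT.
have w0 : (0 < w)%N by exact: leq_ltn_trans vw.
have -> : (w - v = m' * ((w %/ m').-1 - (v %/ m').-1))%N.
  rewrite -{1}(divnK mw) -{1}(divnK mv) -mulnBl mulnC; congr (_ * _)%N.
  have : (0 < v %/ m')%N by rewrite divn_gt0// dvdn_leq.
  have : (0 < w %/ m')%N by rewrite divn_gt0// dvdn_leq.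
  by move: (w %/ m')%N (v %/ m')%N => x y; clear; lia.
by rewrite dvdn_pmul2l// dvdn_sub.
Qed.

Lemma count_sol_near_cover : (count sol_near t <=
  \sum_(1 <= m' < M.+1) \sum_(a <- divisors (totient m'))
    \sum_(1 <= g < M.+1 | near_cond m' a g) count (near_class m' a g) t)%N.
Proof.
pose Q2 m' a v := `[< exists g, [/\ g \in index_iota 1 M.+1, near_cond m' a g &
   near_class m' a g v] >].
pose Q1 m' v := `[< exists2 a, a \in divisors (totient m') & Q2 m' a v >].
apply: leq_trans (count_cover (r := t) (c := xpredT) (Q := Q1) _) _; last first.
  apply: leq_sum => m' _.
  apply: leq_trans (count_cover (r := divisors (totient m')) (c := xpredT)
     (Q := Q2 m') _) _; last first.
    by apply: leq_sum => a _; apply: count_cover => v _ /asboolP.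
  by move=> v _ /asboolP[a aP Qa]; exists a.
move=> v; rewrite mem_index_iota ltnS => /andP[v0 vM].
move=> /asboolP[p [p' [m [m' [sv gs]]]]].
have m'0 := solution_m'_gt0 sv.
have [_ cpm _] := solution_coprime v0 sv.
have [a [a' [g0 pE p'E caa at']]] := solution_gcd v0 sv.
case: sv => pp pp' sp pltp' fv vE _ _ _.
set g := gcdn _ _ in gs g0 pE p'E.
have m'v : (m' <= v)%N by rewrite vE leq_pmulr// prime_gt0.
have m'M : m' \in t by rewrite mem_index_iota m'0 ltnS (leq_trans m'v).
exists m'; split=> //; apply/asboolP; exists a.
  by rewrite -dvdn_divisors// totient_gt0.
apply/asboolP; exists g; split.
- rewrite mem_index_iota g0 ltnS (leq_trans _ vM)// vE.
  rewrite (@leq_trans p')// ?leq_pmull// (leq_trans _ gs)// leq_pmulr//.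
- apply/and3P; split.
  + rewrite (leq_trans _ vM)// vE mulnCA leq_pmul2l//.
  + rewrite (leq_trans _ vM)// vE mulnCA leq_pmul2l// mulnC.
    by apply: leq_trans (ltnW pltp'); rewrite pE.
  + by move: sp; rewrite pE ltnS.
- apply/and4P; split.
  + by rewrite vE dvdn_mulr.
  + by rewrite vE mulKn// p'E/= dvdn_mull.
  + by rewrite -pE fv dvdn_mull.
  + by rewrite -pE.
Qed.

(** The fractions are at most [M / (m' * a * g^2)]. If [a >= s], summing over all [g] suffices; if
    [a < s], the condition [s ^ 2 <= a * g] forces [g >= s]. The terms 1 contribute the number of
    admissible [g], at most [M / (m' * maxn s a)]. *)
Lemma near_inner_sum m' a : (0 < m')%N -> (0 < a)%N ->
  \sum_(1 <= g < M.+1 | near_cond m' a g)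
    (M%:R / (m' * g * (a * g).+1)%:R + 1) <=
  M%:R / m'%:R * (3 / (maxn s a)%:R) :> R.
Proof.
move=> m'0 a0; set K := maxn s a.
have K0 : (0 < K)%N by rewrite leq_max s0.
have m'R : 0 < m'%:R :> R by rewrite ltr0n.
have aR : 0 < a%:R :> R by rewrite ltr0n.
have KR : 0 < K%:R :> R by rewrite ltr0n.
have M0 : 0 <= M%:R :> R by [].
rewrite big_split/=.
have -> : M%:R / m'%:R * (3 / K%:R) =
   M%:R / (m'%:R * a%:R) * (2 * a%:R / K%:R) + M%:R / (m' * K)%:R :> R.
  by rewrite natrM; field; rewrite !gt_eqF.
apply: lerD; last first.
  rewrite sumr1_count; apply: le_trans (natr_divn_le _ _ _).
  rewrite ler_nat; apply: leq_trans (count_mul_le M (_ : 0 < m' * K)%N); last first.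
    by rewrite muln_gt0 m'0.
  by apply: sub_count => g /and3P[h1 h2 _]; rewrite maxnMr maxnMr geq_max h1.
apply: (@le_trans _ _ (\sum_(1 <= g < M.+1 | near_cond m' a g)
   M%:R / (m'%:R * a%:R) * (g%:R ^- 2 : R))).
  rewrite big_nat_cond [leRHS]big_nat_cond; apply: ler_sum => g /andP[/andP[g0 _] _].
  have gR : 0 < g%:R :> R by rewrite ltr0n.
  rewrite -mulrA -invfM ler_wpM2l// lef_pV2 ?posrE ?ltr0n ?muln_gt0 ?m'0 ?g0//; last first.
    by rewrite !mulr_gt0.
  rewrite -natrX -!natrM ler_nat; nia.
rewrite -mulr_sumr ler_wpM2l ?divr_ge0// ?mulr_ge0//.
have F (b : nat) : (0 < b)%N ->
   (forall g, (0 < g)%N -> near_cond m' a g -> (b <= g)%N) ->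
   \sum_(1 <= g < M.+1 | near_cond m' a g) g%:R ^- 2 <= 2 / b%:R :> R.
  move=> b0 H; apply: le_trans (sum_inv_square_le _ M.+1 b0).
  rewrite -big_filter; apply: ler_sum_subset => [g||g].
  - by rewrite invr_ge0 exprn_ge0.
  - by rewrite filter_uniq ?iota_uniq.
  - rewrite mem_filter !mem_index_iota => /andP[cg /andP[g0 ->]].
    by rewrite H.
have [sa|as_] := leqP s a.
  have -> : K = a by apply/maxn_idPr.
  rewrite mulfK ?gt_eqF// (le_trans (F 1%N _ _))// divr1//.
have -> : K = s by apply/maxn_idPl/ltnW.
apply: le_trans (F s s0 _) _.
  move=> g g0 /and3P[_ _ h]; nia.
rewrite ler_wpM2r ?invr_ge0// ler_peMr// ler1n//.
Qed.

(** The maximum dominates the weighted geometric mean [s^(1-e) * a^e]. *)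
Lemma inv_max_le (e : R) (a : nat) : (0 < a)%N -> 0 <= e <= 1 ->
  (maxn s a)%:R^-1 <= s%:R^-1 * s%:R `^ e * a%:R `^ (- e) :> R.
Proof.
move=> a0 /andP[e0 e1].
have aR : 0 < a%:R :> R by rewrite ltr0n.
have sR : 0 < s%:R :> R by rewrite ltr0n.
rewrite powRN -mulrA.
have [sa|as_] := leqP s a; last first.
  rewrite ler_peMr ?invr_ge0// ler_pdivlMr ?powR_gt0// mul1r.
  by rewrite ge0_ler_powR ?nnegrE ?ler_nat// ltnW.
have P (u : R) : 0 < u -> u = u `^ e * u `^ (1 - e).
  move=> u0; rewrite -powRD; first by rewrite addrC subrK powRr1// ltW.
  by rewrite [u == 0]gt_eqF//= implybT.
have se := powR_gt0 e sR; have ae := powR_gt0 e aR.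
have se' := powR_gt0 (1 - e) sR.
have -> : s%:R^-1 * (s%:R `^ e / a%:R `^ e) = (a%:R `^ e * s%:R `^ (1 - e))^-1.
  by rewrite {1}(P _ sR); field; rewrite !gt_eqF.
rewrite lef_pV2 ?posrE ?mulr_gt0// [leRHS](P _ aR) ler_wpM2l ?(ltW ae)//.
by rewrite ge0_ler_powR ?nnegrE ?ler_nat// subr_ge0.
Qed.

Lemma count_sol_near (e : R) : 0 <= e <= 1 ->
  (count sol_near t)%:R <= 3 * M%:R / s%:R * s%:R `^ e *
    \sum_(1 <= m < M.+1) sig e (totient m) / m%:R.
Proof.
move=> e01; apply: (@le_trans _ _ (\sum_(1 <= m' < M.+1)
   \sum_(a <- divisors (totient m'))
   M%:R / m'%:R * (3 * (s%:R^-1 * s%:R `^ e * a%:R `^ (- e))))); last first.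
  rewrite mulr_sumr; apply: ler_sum => m' _.
  by rewrite /sig mulr_suml mulr_sumr; apply: ler_sum => a _; rewrite le_eqVlt;
    apply/orP; left; apply/eqP; ring.
have := count_sol_near_cover; rewrite -(ler_nat R) => /le_trans; apply.
rewrite natr_sum big_nat_cond [leRHS]big_nat_cond; apply: ler_sum => m'.
rewrite andbT => /andP[m'0 _].
rewrite natr_sum big_seq [leRHS]big_seq; apply: ler_sum => a.
rewrite -dvdn_divisors ?totient_gt0// => adv.
have a0 : (0 < a)%N by rewrite (dvdn_gt0 _ adv)// totient_gt0.
apply: (@le_trans _ _ (M%:R / m'%:R * (3 / (maxn s a)%:R))).
  apply: le_trans (near_inner_sum m'0 a0).
  rewrite natr_sum big_nat_cond [leRHS]big_nat_cond; apply: ler_sum => g.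
  move=> /andP[/andP[g0 _] _].
  have := count_near_class a m'0 g0; rewrite -(ler_nat R) => /le_trans; apply.
  by rewrite natrD lerD2r natr_divn_le.
rewrite ler_wpM2l ?divr_ge0// ler_wpM2l// inv_max_le//.
Qed.

Definition far_class (a a' g v : nat) : bool :=
  [&& coprime (a * g).+1 (a' * g).+1, ((a * g).+1 %| f v)%N &
      ((a' * g).+1 %| v)%N].

Lemma count_far_class a a' g :
  (count (far_class a a' g) t <= M %/ ((a * g).+1 * (a' * g).+1) + 1)%N.
Proof.
apply: count_congruent => // v w v0 /andP[vw wM] /and3P[c pv p'v] /and3P[_ pw p'w].
by rewrite Gauss_dvd// (f_dvd_sub v0 vw)//= dvdn_sub.
Qed.

(** From [a' * g < p' < g * s] follows [a < a' < s], and from [s ^ 2 < p' < g * s] follows [g >= s].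
    The last condition is [m * p <= M + 1] with [m > s ^ 2]. *)
Lemma count_sol_far_cover : (count sol_far t <=
  \sum_(1 <= a < s.+1) \sum_(1 <= a' < s.+1)
    \sum_(s <= g < M.+1 | (g * (a * s ^ 2) <= M)%N) count (far_class a a' g) t)%N.
Proof.
pose Q2 a a' v := `[< exists g, [/\ g \in index_iota s M.+1,
   (g * (a * s ^ 2) <= M)%N & far_class a a' g v] >].
pose Q1 a v := `[< exists2 a', a' \in index_iota 1 s.+1 & Q2 a a' v >].
apply: leq_trans (count_cover (r := index_iota 1 s.+1) (c := xpredT) (Q := Q1) _) _; last first.
  apply: leq_sum => a _.
  apply: leq_trans (count_cover (r := index_iota 1 s.+1) (c := xpredT)
     (Q := Q2 a) _) _; last first.
    by apply: leq_sum => a' _; apply: count_cover => v _ /asboolP.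
  by move=> v _ /asboolP[a' aP Qa]; exists a'.
move=> v; rewrite mem_index_iota ltnS => /andP[v0 vM].
move=> /asboolP[p [p' [m [m' [sv ms gs]]]]].
have [_ _ cpp] := solution_coprime v0 sv.
have [a [a' [g0 pE p'E caa at']]] := solution_gcd v0 sv.
case: sv => pp pp' sp pltp' fv vE _ _ _.
set g := gcdn _ _ in gs g0 pE p'E.
have fv1 := f_le v0.
have p1 := prime_gt1 pp.
have aS : (0 < a)%N by case: (a) pE p1 => [->|//]; rewrite mul0n.
have aa' : (a < a')%N by move: pltp'; rewrite pE p'E ltnS ltn_pmul2r.
have a's : (a' < s)%N.
  by move: gs; rewrite p'E mulnC => /ltnW; rewrite ltn_pmul2l.
have aM : (g * (a * s ^ 2) <= M)%N.
  have : ((s ^ 2).+1 * (a * g).+1 <= M.+1)%N.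
    by rewrite -pE (leq_trans (leq_mul ms (leqnn p)))// -fv (leq_trans fv1)// ltnS.
  nia.
exists a; split=> //; first by rewrite mem_index_iota aS ltnS ltnW// (ltn_trans aa').
apply/asboolP; exists a'.
  by rewrite mem_index_iota ltnS (ltnW a's) andbT (ltn_trans _ aa').
apply/asboolP; exists g; split=> //.
- rewrite mem_index_iota ltnS; apply/andP; split.
    rewrite -(leq_pmul2r s0) mulnn; apply: ltnW.
    by rewrite (ltn_trans sp)// (ltn_trans pltp').
  by rewrite (leq_trans _ aM)// leq_pmulr// muln_gt0 aS expn_gt0 s0.
- apply/and3P; split; rewrite -?pE -?p'E//.
    by rewrite fv dvdn_mull.
  by rewrite vE dvdn_mull.
Qed.

(** Summing [g^-2] over [g >= s] gives [2 / s]. The terms 1 number at most [M / (a * s^2)] for each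
    pair [(a, a')], and summing over [a' <= s] returns one factor [s]. *)
Lemma count_sol_far : (s <= M)%N ->
  (count sol_far t)%:R <= 3 * M%:R * harm R M ^+ 2 / s%:R.
Proof.
move=> sM; have M0 : (0 < M)%N by exact: leq_trans sM.
have sR : 0 < s%:R :> R by rewrite ltr0n.
have H1 := @harm_ge1 R _ M0; have Hs := @harm_ge1 R _ s0.
have HM := @harm_le R _ _ sM.
apply: (@le_trans _ _ (M%:R * (2 / s%:R) * harm R s ^+ 2 + M%:R / s%:R * harm R s)); last first.
  have -> : 3 * M%:R * harm R M ^+ 2 / s%:R =
    M%:R * (2 / s%:R) * harm R M ^+ 2 + M%:R / s%:R * harm R M ^+ 2 by ring.
  rewrite lerD// ler_wpM2l ?mulr_ge0 ?invr_ge0//.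
    by rewrite lerXn2r ?nnegrE// ?(le_trans ler01).
  by rewrite (le_trans HM)// ler_eXnr.
have := count_sol_far_cover; rewrite -(ler_nat R) => /le_trans; apply.
have sumH c : \sum_(1 <= a < s.+1) c / a%:R = c * harm R s.
  by rewrite -mulr_sumr.
apply: (@le_trans _ _ (\sum_(1 <= a < s.+1) \sum_(1 <= a' < s.+1)
    (M%:R * (2 / s%:R) / a%:R / a'%:R + M%:R / s%:R ^+ 2 / a%:R))); last first.
  have E (c d x : R) : \sum_(1 <= a' < s.+1) (c / x / a'%:R + d / x) =
      (c * harm R s + d * s%:R) / x.
    by rewrite big_split/= sumH sumr_const_nat subn1/= -[_ *+ s]mulr_natr; ring.
  under eq_bigr do rewrite E.
  by rewrite sumH le_eqVlt; apply/orP; left; apply/eqP; field; rewrite gt_eqF.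
rewrite natr_sum big_nat_cond [leRHS]big_nat_cond; apply: ler_sum => a.
rewrite andbT => /andP[a0 _].
rewrite natr_sum big_nat_cond [leRHS]big_nat_cond; apply: ler_sum => a'.
rewrite andbT => /andP[a'0 _].
have aR : 0 < a%:R :> R by rewrite ltr0n.
have a'R : 0 < a'%:R :> R by rewrite ltr0n.
apply: (@le_trans _ _ (\sum_(s <= g < M.+1 | (g * (a * s ^ 2) <= M)%N)
   (M%:R / a%:R / a'%:R * (g%:R ^- 2 : R) + 1))).
  rewrite natr_sum big_nat_cond [leRHS]big_nat_cond; apply: ler_sum => g.
  move=> /andP[/andP[sg _] _]; have g0 : (0 < g)%N by exact: leq_trans sg.
  have gR : 0 < g%:R :> R by rewrite ltr0n.
  have := count_far_class a a' g; rewrite -(ler_nat R) => /le_trans; apply.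
  rewrite natrD lerD2r (le_trans (natr_divn_le _ _ _))// -!mulrA -!invfM ler_wpM2l//.
  rewrite lef_pV2 ?posrE ?ltr0n//; last by rewrite !mulr_gt0// exprn_gt0.
  rewrite -natrX -!natrM ler_nat; nia.
rewrite big_split/=; apply: lerD.
  rewrite -mulr_sumr.
  have -> : M%:R * (2 / s%:R) / a%:R / a'%:R = M%:R / a%:R / a'%:R * (2 / s%:R) :> R by ring.
  rewrite ler_wpM2l ?divr_ge0// (le_trans _ (sum_inv_square_le R M.+1 s0))//.
  by rewrite big_mkcond; apply: ler_sum => g _; case: ifP => // _.
rewrite sumr1_count.
have -> : M%:R / s%:R ^+ 2 / a%:R = M%:R / (a * s ^ 2)%:R :> R.
  by rewrite natrM natrX; field; rewrite !gt_eqF.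
apply: le_trans (natr_divn_le _ _ _).
have as0 : (0 < a * s ^ 2)%N by rewrite muln_gt0 a0 expn_gt0 s0.
rewrite ler_nat; apply: leq_trans (count_mul_le M as0).
rewrite -!size_filter; apply: uniq_leq_size; first by rewrite filter_uniq ?iota_uniq.
move=> g; rewrite !mem_filter !mem_index_iota => /andP[-> /andP[sg ->]].
by rewrite (leq_trans _ sg).
Qed.

Lemma count_has_solution (e : R) : 0 <= e <= 1 -> (s <= M)%N ->
  (count (has_solution s) t)%:R <=
  3 * M%:R / s%:R * s%:R `^ e * \sum_(1 <= m < M.+1) sig e (totient m) / m%:R +
  s%:R ^+ 4 + 3 * M%:R * harm R M ^+ 2 / s%:R.
Proof.
move=> e01 sM; have := count_solution_split; rewrite -(ler_nat R) => /le_trans; apply.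
rewrite !natrD addrA lerD ?count_sol_far// lerD ?count_sol_near//.
by rewrite -natrX ler_nat count_sol_small.
Qed.

End Bound.
End Solutions.

(** * Reduction of the coincidence count to the preceding bounds *)

Lemma large_simple_primeP s v : has_large_simple_prime s v ->
  exists p m, [/\ prime p, (s ^ 2 < p)%N, v = (m * p)%N & ~~ (p %| m)%N].
Proof.
move=> /hasP[p]; rewrite mem_primes => /and3P[pp v0 /dvdnP[m vE]] /andP[sp pv].
exists p, m; split=> //; apply: contra pv => /dvdnP[k mE].
by rewrite vE mE -mulnA mulnn dvdn_mull.
Qed.

(** The two large primes differ because [n] and [n.+1] are coprime; which is larger decides between
    [predn] at [n.+1] and [succn] at [n]. *)
Lemma coincidence_cases s n : (0 < n)%N -> totient n = totient n.+1 ->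
  [|| ~~ has_large_simple_prime s n, ~~ has_large_simple_prime s n.+1,
      has_solution predn s n.+1 | has_solution succn s n].
Proof.
move=> n0 tn; rewrite -implyNb negbK; apply/implyP => /large_simple_primeP[p [m [pp sp nE pm]]].
rewrite -implyNb negbK; apply/implyP => /large_simple_primeP[q [l [pq sq n1E ql]]].
have pq' : p != q.
  apply/negP => /eqP E; have : coprime (m * p) (l * q) by rewrite -nE -n1E coprimenS.
  rewrite E coprimeMl !coprimeMr => /andP[_ /andP[_]].
  by rewrite /coprime gcdnn => /eqP q1; rewrite q1 in pq.
move: pq'; rewrite neq_ltn => /orP[pltq|qltp]; apply/orP; [left|right].
  by apply/asboolP; exists p, q, m, l; split.
by apply/asboolP; exists q, p, l, m; split.
Qed.

Lemma count_iota_succ (P : pred nat) N :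
  (count (fun n => P n.+1) (index_iota 1 N.+1) <= count P (index_iota 1 N.+2))%N.
Proof.
rewrite -(count_map succn P) /index_iota !subn1/=.
have -> : iota 2 N = map succn (iota 1 N) by rewrite -(iotaDl 1 1).
exact: leq_addl.
Qed.

Lemma count_iota_widen (P : pred nat) N :
  (count P (index_iota 1 N.+1) <= count P (index_iota 1 N.+2))%N.
Proof.
rewrite /index_iota !subn1 [X in (_ <= count _ X)%N](_ : _ = iota 1 N ++ iota (1 + N) 1).
  by rewrite count_cat leq_addr.
by rewrite -iotaD addn1.
Qed.

(** Each term appears twice, once for each neighbour; [M = N.+1] leaves room for [n.+1]. *)
Lemma coincidences_bound (R : realType) (N M s k A : nat) (e : R) : M = N.+1 ->
  (0 < s)%N -> (0 < A)%N -> (s ^ (2 * k + 3) <= M)%N -> 0 <= e <= 1 ->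
  (count (fun n => totient n == totient n.+1) (index_iota 1 N.+1))%:R <=
  2 * (3 * M%:R / s%:R + M%:R * harm R M ^+ A / A%:R ^+ k) +
  2 * (3 * M%:R / s%:R * s%:R `^ e * \sum_(1 <= m < M.+1) sig e (totient m) / m%:R +
       s%:R ^+ 4 + 3 * M%:R * harm R M ^+ 2 / s%:R).
Proof.
move=> ME s0 A0 sM e01.
have sleM : (s <= M)%N.
  by apply: leq_trans sM; rewrite -{1}(expn1 s) leq_pexp2l// addn3.
pose B v := ~~ has_large_simple_prime s v.
have C : (count (fun n => totient n == totient n.+1) (index_iota 1 N.+1) <=
   count B (index_iota 1 M.+1) + (count B (index_iota 1 M.+1) +
   (count (has_solution predn s) (index_iota 1 M.+1) +
    count (has_solution succn s) (index_iota 1 M.+1))))%N.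
  apply: (@leq_trans (count B (index_iota 1 N.+1) +
    (count (fun n => B n.+1) (index_iota 1 N.+1) +
    (count (fun n => has_solution predn s n.+1) (index_iota 1 N.+1) +
     count (has_solution succn s) (index_iota 1 N.+1))))%N); last first.
    rewrite ME; apply: leq_add; first exact: count_iota_widen.
    apply: leq_add; first exact: (count_iota_succ B).
    by apply: leq_add; [exact: (count_iota_succ (has_solution predn s))|
      exact: count_iota_widen].
  apply: leq_trans (count_le_add _ (Q := B) (Q' := fun n => [|| B n.+1,
     has_solution predn s n.+1 | has_solution succn s n])) _.
    move=> n; rewrite mem_index_iota => /andP[n0 _] /eqP.
    exact: coincidence_cases.
  rewrite leq_add2l; apply: leq_trans (count_le_add _ (Q := fun n => B n.+1) (Q' := fun n => 
     has_solution predn s n.+1 || has_solution succn s n)) _.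
    by move=> n _ ->.
  by rewrite leq_add2l count_le_add.
have HB := count_no_large_simple_prime R s0 A0 sM.
have HS f H1 H2 H3 H4 := @count_has_solution f H1 H2 H3 H4 R s M s0 e e01 sleM.
have Hp : (count (has_solution predn s) (index_iota 1 M.+1))%:R <=
  3 * M%:R / s%:R * s%:R `^ e * \sum_(1 <= m < M.+1) sig e (totient m) / m%:R +
  s%:R ^+ 4 + 3 * M%:R * harm R M ^+ 2 / s%:R.
  apply: HS => v; [lia|lia|lia|exact: coprimePn].
have Hs : (count (has_solution succn s) (index_iota 1 M.+1))%:R <=
  3 * M%:R / s%:R * s%:R `^ e * \sum_(1 <= m < M.+1) sig e (totient m) / m%:R +
  s%:R ^+ 4 + 3 * M%:R * harm R M ^+ 2 / s%:R.
  apply: HS => v; [lia|lia|lia|by rewrite coprimeSn].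
move: C; rewrite -(ler_nat R) !natrD => /le_trans; apply.
rewrite addrA; apply: lerD; rewrite [leRHS]mulrDl mul1r; exact: lerD.
Qed.

(** * Choice of parameters and asymptotic estimates *)

Lemma ln2_le1 (R : realType) : ln (2 : R) <= 1.
Proof. have := @le_ln1Dx R 1; rewrite (_ : 1 + 1 = 2)//; apply; lra. Qed.

Section Asymptotics.
Variables (R : realType) (d x : R).
Let l : R := ln x.
Let lam : R := ln l.
Let T : R := Num.sqrt l.
Let r : R := Num.sqrt lam.
Let Q : R := T * r.
Hypothesis d01 : 0 < d <= 1.
(** The sole largeness assumption on [x], in terms of the fixed [d]; all later numerical comparisons
    rest on it. *)
Hypothesis r_large : 100 / d ^+ 2 <= r.

Local Lemma d_gt0 : 0 < d. Proof. by case/andP: d01. Qed.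
Local Lemma d_le1 : d <= 1. Proof. by case/andP: d01. Qed.
#[local] Hint Resolve d_gt0 d_le1 : core.

Local Lemma dd_r : 100 <= d ^+ 2 * r.
Proof. by rewrite mulrC -ler_pdivrMr// exprn_gt0. Qed.
#[local] Hint Resolve dd_r : core.

Local Lemma d_r : 100 <= d * r.
Proof.
have r0 : 0 <= r by exact: sqrtr_ge0.
apply: (le_trans dd_r); rewrite expr2 -mulrA ler_piMl// mulr_ge0// ltW//.
Qed.

Local Lemma r_ge : 100 <= r.
Proof.
have r0 : 0 <= r by exact: sqrtr_ge0.
by apply: (le_trans d_r); rewrite ler_piMl.
Qed.

Local Lemma r_gt0 : 0 < r. Proof. by move: r_ge; lra. Qed.
#[local] Hint Resolve r_gt0 : core.

Local Lemma lam_gt0 : 0 < lam. Proof. by rewrite -sqrtr_gt0. Qed.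
#[local] Hint Resolve lam_gt0 : core.

Local Lemma lamE : lam = r ^+ 2. Proof. by rewrite sqr_sqrtr// ltW. Qed.

Local Lemma l_gt0 : 0 < l.
Proof. by rewrite ltNge; apply/negP => /ln0 E; move: lam_gt0; rewrite /lam E ltxx. Qed.
#[local] Hint Resolve l_gt0 : core.

Local Lemma lE : l = expR lam. Proof. by rewrite lnK ?posrE. Qed.

Local Lemma x_gt0 : 0 < x.
Proof. by rewrite ltNge; apply/negP => /ln0 E; move: l_gt0; rewrite /l E ltxx. Qed.
#[local] Hint Resolve x_gt0 : core.

Local Lemma xE : x = expR l. Proof. by rewrite lnK ?posrE. Qed.

Local Lemma T_gt0 : 0 < T. Proof. by rewrite sqrtr_gt0. Qed.
#[local] Hint Resolve T_gt0 : core.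

Local Lemma lT : l = T ^+ 2. Proof. by rewrite sqr_sqrtr// ltW. Qed.

Local Lemma TE : T = expR (lam / 2).
Proof.
by apply/eqP; rewrite -(eqrXn2 (n := 2)) ?expR_ge0 ?ltW// -lT lE -expRM_natr -mulrA mulVf ?mulr1.
Qed.

Local Lemma lam_ge : 10000 <= lam.
Proof. rewrite lamE; move: r_ge; nra. Qed.

Local Lemma T_ge : 2 * lam ^+ 2 <= T.
Proof.
rewrite TE; have h : 0 <= lam / 2 by rewrite divr_ge0// ltW.
have := expR_ge1Dxn 2 h; apply: le_trans.
have -> : (3`!%:R : R) = 6 by [].
rewrite expr_div_n.
(* The cubic term of the exponential series is [lam^3 / 48], which is at least [2 * lam^2] once
   [lam >= 96]. *)
have : 0 <= lam ^+ 2 * (lam - 96).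
  by rewrite mulr_ge0 ?exprn_ge0 ?(ltW lam_gt0)//; move: lam_ge; lra.
lra.
Qed.

Local Lemma T_ge_lam : 100 * lam <= T.
Proof. apply: le_trans T_ge; move: lam_ge; nra. Qed.

Local Lemma r_le_lam : r <= lam.
Proof. by rewrite lamE expr2 ler_peMr ?(ltW r_gt0)//; move: r_ge; lra. Qed.
#[local] Hint Resolve r_le_lam : core.

Local Lemma QE : Q = Num.sqrt (l * lam). Proof. by rewrite sqrtrM// ltW. Qed.

(** Errors of order [T] in the exponent are absorbed by [d * Q], as [Q = T * r] and
    [d * r >= 100]. *)
Local Lemma T_le_dQ c : c <= 100 -> c * T <= d * Q.
Proof.
move=> c100; rewrite /Q mulrCA [leLHS]mulrC ler_wpM2l ?(ltW T_gt0)//.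
exact: le_trans d_r.
Qed.

Local Lemma lam_le_dQ : 100 * lam <= d * Q.
Proof.
apply: le_trans (T_le_dQ (lexx _)); rewrite ler_wpM2l//.
by move: T_ge_lam lam_gt0; lra.
Qed.

Local Lemma Q_gt0 : 0 < Q. Proof. by rewrite mulr_gt0. Qed.
#[local] Hint Resolve Q_gt0 : core.

Local Lemma Q_le : 3 * Q <= l.
Proof.
rewrite lT expr2 /Q mulrCA ler_wpM2l ?(ltW T_gt0)//.
by apply: le_trans T_ge_lam; rewrite ler_pM// ?(ltW r_gt0)//; lra.
Qed.

(** As [lam = r ^+ 2], the logarithm is at most [1 + 2 * r], which [d * r >= 100] puts below
    [d / 2 * r ^+ 2]. *)
Local Lemma ln_2lam : ln (2 * lam) <= d / 2 * lam.
Proof.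
rewrite lamE lnM ?posrE ?exprn_gt0//.
have h1 := ln2_le1 R.
have h2 : ln (r ^+ 2) <= 2 * r.
  rewrite lnXn// mulr_natl lerMn2r/=.
  exact/ltW/ln_sublinear.
move: d_r r_ge h1 h2; nra.
Qed.
#[local] Hint Resolve ln_2lam : core.

Local Lemma ln_2lam_ge0 : 0 <= ln (2 * lam).
Proof. by rewrite ln_ge0//; move: lam_ge; lra. Qed.

(* The parameters of [coincidences_bound]; then [s ~ exp(Q / 2)]. *)
Let M := (Num.truncn x).+1.
Let s := Num.truncn (expR (Q / 2)).
Let A := Num.truncn (T / lam).
Let k := (Num.truncn (T / r) - 2)%N.

Local Lemma x_ge1 : 1 <= x. Proof. by rewrite xE -expR0 ler_expR ltW. Qed.

Local Lemma M_le : M%:R <= 2 * x.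
Proof.
have : (Num.truncn x)%:R <= x by rewrite truncn_le ltW.
by rewrite /M -natr1; move: x_ge1; lra.
Qed.
#[local] Hint Resolve M_le : core.

Local Lemma x_le_M : x <= M%:R. Proof. by rewrite ltW// truncnS_gt. Qed.

Local Lemma s_le : s%:R <= expR (Q / 2). Proof. by rewrite truncn_le expR_ge0. Qed.
#[local] Hint Resolve s_le : core.

Local Lemma S_ge : 2 <= expR (Q / 2).
Proof.
apply: le_trans (expR_ge1Dx _).
have : 100 * lam <= Q by apply: le_trans lam_le_dQ _; rewrite ler_piMl// ltW.
by move: lam_ge; lra.
Qed.

Local Lemma s_gt0 : (0 < s)%N.
Proof. by rewrite truncn_gt0; move: S_ge; lra. Qed.
#[local] Hint Resolve s_gt0 : core.

Local Lemma s_ge : expR (Q / 2) <= 2 * s%:R.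
Proof.
have := truncnS_gt (expR (Q / 2)); rewrite -/s -natr1.
have : 1 <= s%:R :> R by rewrite ler1n.
lra.
Qed.
#[local] Hint Resolve s_ge : core.

Local Lemma sV_le : s%:R^-1 <= 2 * expR (- (Q / 2)) :> R.
Proof.
rewrite expRN ler_pdivlMr ?expR_gt0// mulrC ler_pdivrMr ?ltr0n//.
Qed.
#[local] Hint Resolve sV_le : core.

Local Lemma harm_M_le : harm R M <= expR (2 * lam).
Proof.
apply: le_trans (harm_le_ln _ _) _ => //.
have lnM_le : ln (M%:R : R) <= 1 + l.
  apply: (@le_trans _ _ (ln (2 * x))).
    by rewrite ler_ln ?posrE ?ltr0n// mulr_gt0.
  rewrite lnM ?posrE// lerD2r.
  exact: ln2_le1.
rewrite mulrC expRM_natr -lE expr2.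
have : 1 + lam <= l by rewrite lE expR_ge1Dx.
by move: lam_ge lnM_le; nra.
Qed.
#[local] Hint Resolve harm_M_le : core.

Local Lemma lnM_le : ln (M%:R : R) <= 2 * l.
Proof.
apply: (@le_trans _ _ (ln (2 * x))).
  by rewrite ler_ln ?posrE ?ltr0n// mulr_gt0.
rewrite lnM ?posrE//.
have h1 := ln2_le1 R.
have : 1 + lam <= l by rewrite lE expR_ge1Dx.
by move: lam_ge h1; rewrite /l; lra.
Qed.

Local Lemma A_le : A%:R <= T / lam. Proof. by rewrite truncn_le divr_ge0 ?ltW. Qed.
#[local] Hint Resolve A_le : core.

Local Lemma A_ge : T / (2 * lam) <= A%:R.
Proof.
have := truncnS_gt (T / lam); rewrite -/A -natr1.
have : 2 <= T / lam.
  rewrite ler_pdivlMr//; apply: le_trans T_ge_lam.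
  by rewrite ler_wpM2r ?(ltW lam_gt0)//; lra.
have -> : T / (2 * lam) = (T / lam) / 2 by field; rewrite gt_eqF.
lra.
Qed.
#[local] Hint Resolve A_ge : core.

Local Lemma A_gt0 : (0 < A)%N.
Proof.
by rewrite -(ltr0n R); apply: lt_le_trans A_ge; rewrite divr_gt0// mulr_gt0.
Qed.
#[local] Hint Resolve A_gt0 : core.

Local Lemma Tr_ge : 3 <= T / r.
Proof.
rewrite ler_pdivlMr//; apply: le_trans T_ge_lam.
by rewrite ler_pM// ?(ltW r_gt0)//; lra.
Qed.
#[local] Hint Resolve Tr_ge : core.

Local Lemma k_ge : T / r - 3 <= k%:R.
Proof.
have := truncnS_gt (T / r); rewrite -natr1 /k natrB; first lra.
by rewrite truncn_ge_nat ?divr_ge0 ?(ltW T_gt0) ?(ltW r_gt0)//; move: Tr_ge; lra.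
Qed.
#[local] Hint Resolve k_ge : core.

Local Lemma k_le : k%:R <= T / r - 2.
Proof.
have : (Num.truncn (T / r))%:R <= T / r by rewrite truncn_le divr_ge0 ?ltW.
rewrite /k natrB; first lra.
by rewrite truncn_ge_nat ?divr_ge0 ?(ltW T_gt0) ?(ltW r_gt0)//; move: Tr_ge; lra.
Qed.

(** [(Q / 2) * (2 * T / r) = T^2 = ln x], and the 2 subtracted in [k] keeps [2 * k + 3] below
    [2 * T / r]. *)
Local Lemma s_exp_le : (s ^ (2 * k + 3) <= M)%N.
Proof.
rewrite -(ler_nat R) natrX; apply: le_trans x_le_M.
apply: (@le_trans _ _ (expR (Q / 2) ^+ (2 * k + 3))).
  by rewrite lerXn2r ?nnegrE ?expR_ge0.
rewrite -expRM_natr xE ler_expR natrD natrM.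
have -> : l = Q / 2 * (2 * (T / r)) by rewrite lT /Q; field; rewrite gt_eqF.
rewrite ler_wpM2l ?divr_ge0 ?(ltW Q_gt0)//; move: k_le; lra.
Qed.

Local Lemma M_div_s_le : 3 * M%:R / s%:R <= 12 * (x * expR (- (Q / 2))).
Proof.
have : M%:R * s%:R^-1 <= (2 * x) * (2 * expR (- (Q / 2))).
  by rewrite ler_pM ?invr_ge0.
lra.
Qed.

(** Linear arithmetic applied with [q = T / r], [y = lam], [u = ln (2 * lam)], [n = k], [v = ln A],
    [q' = Q] and [D = d * Q]. *)
Local Lemma omega_exponent_le (y u v q n D q' : R) : (q - 3) * (y / 2 - u) <= n * v ->
  q * (y / 2) = q' / 2 -> q * u <= D / 2 -> 0 <= u -> 100 * y <= D -> 0 < y ->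
  - (n * v) <= - (q' / 2) + D.
Proof. by rewrite mulrBl mulrBr => h1 h2; move: h1; rewrite h2; lra. Qed.

(** The harmonic power is at most [expR (2 * T)], while [k * ln A] is about
    [(T / r) * (lam / 2) = Q / 2], the same saving as from [s]. *)
Local Lemma omega_term_le : M%:R * harm R M ^+ A / A%:R ^+ k <=
  2 * (x * expR (- (Q / 2) + 2 * (d * Q))).
Proof.
have hA : harm R M ^+ A <= expR (d * Q).
  apply: (@le_trans _ _ (expR (2 * lam) ^+ A)).
    by rewrite lerXn2r ?nnegrE ?expR_ge0// (le_trans ler01) ?harm_ge1.
  rewrite -expRM_natr ler_expR; apply: le_trans (T_le_dQ (_ : 2 <= 100)); last lra.
  rewrite -mulrA ler_wpM2l// mulrC; by rewrite -ler_pdivlMr.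
have hk : (A%:R ^+ k)^-1 <= expR (- (Q / 2) + d * Q).
  have A0 : 0 < A%:R :> R by rewrite ltr0n.
  rewrite -[leLHS]lnK ?posrE ?invr_gt0 ?exprn_gt0// ler_expR.
  rewrite lnV ?posrE ?exprn_gt0// lnXn// -[_ *+ k]mulr_natl.
  have lA : lam / 2 - ln (2 * lam) <= ln (A%:R : R).
    apply: (@le_trans _ _ (ln (T / (2 * lam)))).
      by rewrite ln_div ?posrE ?mulr_gt0// lerD2r TE expRK.
    by rewrite ler_ln ?posrE// divr_gt0 ?mulr_gt0.
  have c0 : 0 <= lam / 2 - ln (2 * lam).
    by rewrite subr_ge0 (le_trans ln_2lam)// mulrAC ler_wpM2r// ler_piMl// ltW.
  have c5 : 0 <= T / r - 3 by rewrite subr_ge0.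
  have c1 : (T / r - 3) * (lam / 2 - ln (2 * lam)) <= k%:R * ln (A%:R : R).
    by rewrite ler_pM.
  have c2 : (T / r) * (lam / 2) = Q / 2.
    by rewrite lamE /Q; field; rewrite gt_eqF.
  have c3 : (T / r) * ln (2 * lam) <= d * Q / 2.
    apply: (@le_trans _ _ ((T / r) * (d / 2 * lam))).
      by rewrite ler_wpM2l// divr_ge0 ?ltW.
    by rewrite le_eqVlt; apply/orP; left; apply/eqP; rewrite lamE /Q; field; rewrite gt_eqF.
  exact: omega_exponent_le c1 c2 c3 ln_2lam_ge0 lam_le_dQ lam_gt0.
have -> : 2 * (x * expR (- (Q / 2) + 2 * (d * Q))) =
   (2 * x) * expR (d * Q) * expR (- (Q / 2) + d * Q).
  by rewrite -!mulrA -expRD; congr (_ * (_ * expR _)); ring.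
have h0 : 0 <= harm R M by rewrite (le_trans ler01) ?harm_ge1.
rewrite ler_pM ?invr_ge0 ?exprn_ge0// ?mulr_ge0 ?exprn_ge0//.
by rewrite ler_pM ?exprn_ge0.
Qed.

Local Lemma near_term_le : 3 * M%:R / s%:R * s%:R `^ d *
    (\sum_(1 <= m < M.+1) sig d (totient m) / m%:R) <=
  12 * (x * expR (- (Q / 2) + 2 * (d * Q))).
Proof.
have hs : s%:R `^ d <= expR (d * Q).
  apply: (@le_trans _ _ (expR (Q / 2) `^ d)).
    by rewrite ge0_ler_powR ?nnegrE ?expR_ge0// ltW.
  rewrite -expRM ler_expR mulrC ler_wpM2l ?(ltW d_gt0)//.
  by move: Q_gt0; lra.
have TV : 0 < T^-1 by rewrite invr_gt0.
(* Rankin's exponent [t = T^-1] makes both [t * ln M] and [B] of order [T] for fixed [d]; the factor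
   [1 / d] in [B] is paid by [d ^+ 2 * r >= 100]. *)
have := sum_sig_totient_le d_gt0 TV M (erefl _); rewrite invrK.
set B := (1 + d^-1) * (1 + T); set Phi := \sum_(_ <= _ < _) _ => hPhi.
have B0 : 0 <= B by rewrite mulr_ge0// addr_ge0// ?invr_ge0 ltW.
have hM : M%:R `^ T^-1 <= expR (2 * T).
  rewrite /powR pnatr_eq0 /= ler_expR ler_pdivrMl// mulrCA -expr2 -lT.
  exact: lnM_le.
have hB : B * expR (2 * (1 + B)) <= expR (2 + 3 * B).
  have -> : 2 + 3 * B = B + 2 * (1 + B) by ring.
  rewrite expRD ler_wpM2r ?expR_ge0// (le_trans _ (expR_ge1Dx _))//; lra.
have BT : 2 * T + (2 + 3 * B) <= d * Q.
  have T1 : 1 <= T by move: T_ge_lam lam_ge; lra.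
  have B_le : B <= 2 * (1 + d^-1) * T.
    have -> : 2 * (1 + d^-1) * T = (1 + d^-1) * (2 * T) by ring.
    by rewrite ler_wpM2l ?addr_ge0 ?invr_ge0 ?(ltW d_gt0)//; move: T1; lra.
  have dV : 1 <= d^-1 by rewrite invf_ge1.
  have dVr : 100 * d^-1 <= d * r.
    by rewrite ler_pdivrMr// mulrAC -expr2.
  have : 2 * T + (2 + 3 * B) <= (100 * d^-1) * T by move: T1 B_le dV; nra.
  move/le_trans; apply; rewrite /Q mulrCA [leLHS]mulrC ler_wpM2l// ltW//.
have hPhi' : Phi <= expR (d * Q).
  apply: (le_trans hPhi); apply: (@le_trans _ _ (expR (2 * T) * expR (2 + 3 * B))).
    by rewrite ler_pM ?powR_ge0// mulr_ge0 ?expR_ge0.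
  by rewrite -expRD ler_expR.
have -> : 12 * (x * expR (- (Q / 2) + 2 * (d * Q))) =
   12 * (x * expR (- (Q / 2))) * expR (d * Q) * expR (d * Q).
  by rewrite -!mulrA -!expRD; congr (_ * (_ * expR _)); ring.
have P0 : 0 <= Phi by apply: sumr_ge0 => m _; rewrite mulr_ge0 ?sig_ge0 ?invr_ge0.
have m0 : 0 <= 3 * M%:R / s%:R :> R by rewrite !mulr_ge0 ?invr_ge0.
rewrite ler_pM ?mulr_ge0 ?powR_ge0//.
by rewrite ler_pM ?powR_ge0 ?M_div_s_le.
Qed.

(** Here [2 * Q <= l - Q / 2] follows from [3 * Q <= l]. *)
Local Lemma small_term_le : s%:R ^+ 4 <= x * expR (- (Q / 2)).
Proof.
apply: (@le_trans _ _ (expR (Q / 2) ^+ 4)); first by rewrite lerXn2r ?nnegrE ?expR_ge0.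
rewrite -expRM_natr xE -expRD ler_expR; move: Q_le Q_gt0; lra.
Qed.

Local Lemma far_term_le : 3 * M%:R * harm R M ^+ 2 / s%:R <=
  12 * (x * expR (- (Q / 2) + 2 * (d * Q))).
Proof.
have hH : harm R M ^+ 2 <= expR (2 * (d * Q)).
  apply: (@le_trans _ _ (expR (2 * lam) ^+ 2)).
    by rewrite lerXn2r ?nnegrE ?expR_ge0// (le_trans ler01) ?harm_ge1.
  rewrite -expRM_natr ler_expR; move: lam_le_dQ lam_gt0; lra.
have -> : 3 * M%:R * harm R M ^+ 2 / s%:R = 3 * M%:R / s%:R * harm R M ^+ 2 by ring.
have -> : 12 * (x * expR (- (Q / 2) + 2 * (d * Q))) =
   12 * (x * expR (- (Q / 2))) * expR (2 * (d * Q)).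
  by rewrite -!mulrA -expRD.
have h0 : 0 <= harm R M by rewrite (le_trans ler01) ?harm_ge1.
by rewrite ler_pM ?M_div_s_le ?exprn_ge0 ?mulr_ge0 ?invr_ge0.
Qed.

(** The constant is [78 = 2 * (12 + 2) + 2 * (12 + 1 + 12)]. *)
Local Lemma sum_terms (t1 t2 t3 t4 t5 E1 E G : R) :
  t1 <= 12 * E1 -> t2 <= 2 * E -> t3 <= 12 * E -> t4 <= E1 -> t5 <= 12 * E ->
  E1 <= E -> 78 * E <= G -> 2 * (t1 + t2) + 2 * (t3 + t4 + t5) <= G.
Proof. lra. Qed.

Lemma totient_coincidences_le : (totient_coincidences x)%:R <=
  x * expR (- (2^-1 - 3 * d) * Num.sqrt (ln x * loglog x)).
Proof.
have -> : Num.sqrt (ln x * loglog x) = Q by rewrite QE.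
have d01' : 0 <= d <= 1 by rewrite d_le1 ltW.
apply: le_trans (coincidences_bound (erefl M) s_gt0 A_gt0 s_exp_le d01') _.
set E := x * expR (- (Q / 2) + 2 * (d * Q)).
have E1 : x * expR (- (Q / 2)) <= E.
  rewrite ler_wpM2l ?(ltW x_gt0)// ler_expR lerDl !mulr_ge0// ltW//.
(* The third [d * Q] absorbs the constant, since [expR (d * Q) >= 1 + d * Q] and
   [d * Q >= 100 * lam]. *)
have E2 : 78 * E <= x * expR (- (2^-1 - 3 * d) * Q).
  rewrite mulrCA ler_wpM2l ?(ltW x_gt0)//.
  have -> : - (2^-1 - 3 * d) * Q = d * Q + (- (Q / 2) + 2 * (d * Q)) by ring.
  rewrite [leRHS]expRD ler_wpM2r ?expR_ge0// (le_trans _ (expR_ge1Dx _))//.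
  by move: lam_le_dQ lam_ge; lra.
exact: sum_terms M_div_s_le omega_term_le near_term_le small_term_le far_term_le E1 E2.
Qed.

End Asymptotics.

(** * Passage to a single error function tending to 0 *)

Lemma near_sqrt_loglog_ge (R : realType) (K : R) :
  \forall x \near +oo, K <= Num.sqrt (loglog x).
Proof.
near=> x.
have hx : expR (expR (K ^+ 2)) <= x by near: x; apply: nbhs_pinfty_ge; exact: num_real.
apply: (le_trans (ler_norm K)); rewrite -sqrtr_sqr ler_wsqrtr// /loglog.
have x0 : 0 < x := lt_le_trans (expR_gt0 _) hx.
have h1 : expR (K ^+ 2) <= ln x by rewrite -[leLHS]expRK ler_ln ?posrE ?expR_gt0.
rewrite -[leLHS]expRK ler_ln ?posrE ?expR_gt0//.
exact: lt_le_trans (expR_gt0 _) h1.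
Unshelve. all: by end_near.
Qed.

Theorem corollary1p5 (R : realType) :
  exists2 eps : R -> R,
    eps x @[x --> +oo] --> 0 &
    (fun x : R => (totient_coincidences x)%:R : R) =O_ (pinfty_nbhs R)
    (fun x : R =>
       x * expR (- (2^-1 - eps x) * Num.sqrt (ln x * loglog x))).
Proof.
pose Q (x : R) := Num.sqrt (ln x * loglog x).
pose c (x : R) : R := (totient_coincidences x)%:R.
(* The least nonnegative exponent correction that makes the bound hold with constant 1 when [c x] is
   nonzero and [x] is large; so only its convergence needs the estimates above. A zero count is
   treated apart because of the logarithm. *)
pose eps (x : R) := if c x == 0 then 0 else Num.max 0 (2^-1 + ln (c x / x) / Q x).
have r_oo := @near_sqrt_loglog_ge R.
have Q_pos (x : R) : 0 < Num.sqrt (loglog x) -> 0 < x /\ 0 < Q x.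
  rewrite sqrtr_gt0 /Q sqrtr_gt0 => h.
  have l0 : 0 < ln x.
    by rewrite ltNge; apply/negP => /ln0 E; move: h; rewrite /loglog E ltxx.
  split; last by rewrite mulr_gt0.
  by rewrite ltNge; apply/negP => /ln0 E; move: l0; rewrite E ltxx.
exists eps.
  apply/cvgrPdist_le => e e0.
  (* The loss in the exponent is [3 * d], and [d] may not exceed 1. *)
  pose d := Num.min 1 (e / 3).
  have d01 : 0 < d <= 1.
    by rewrite lt_min ltr01 divr_gt0//= ge_min lexx.
  have de : 3 * d <= e.
    by rewrite mulrC -ler_pdivlMr// ge_min lexx orbT.
  near=> x.
  have r_large : 100 / d ^+ 2 <= Num.sqrt (loglog x) by near: x; exact: r_oo.
  have := totient_coincidences_le d01 r_large; rewrite -/(c x) -/(Q x).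
  have [|x0 Q0] := Q_pos x.
    by apply: lt_le_trans r_large; rewrite divr_gt0// exprn_gt0//; case/andP: d01.
  rewrite sub0r normrN /eps; case: eqP => [_ _|/eqP c0 cx]; first by rewrite normr0 ltW.
  have cx0 : 0 < c x by rewrite lt_neqAle eq_sym c0 ler0n.
  rewrite ger0_norm ?le_max ?lexx// ge_max (ltW e0)/=.
  have : ln (c x / x) <= - (2^-1 - 3 * d) * Q x.
    rewrite -[leRHS]expRK ler_ln ?posrE ?divr_gt0 ?expR_gt0//.
    by rewrite ler_pdivrMr// mulrC.
  rewrite -ler_pdivrMr//; lra.
apply/eqO_exP; exists 1 => //; near=> x.
have [|x0 Q0] := Q_pos x.
  by apply: (@lt_le_trans _ _ 1); rewrite // ; near: x; exact: r_oo.
rewrite mul1r -/(c x) -/(Q x) /eps.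
rewrite [`|c x|]ger0_norm ?ler0n// [leRHS]ger0_norm; last by rewrite mulr_ge0 ?expR_ge0 ?ltW.
case: eqP => [->|/eqP c0]; first by rewrite mulr_ge0 ?expR_ge0 ?ltW.
have cx0 : 0 < c x by rewrite lt_neqAle eq_sym c0 ler0n.
rewrite mulrC -ler_pdivrMr// -[leLHS]lnK ?posrE ?divr_gt0// ler_expR.
rewrite -ler_pdivrMr//.
set u := ln _ / _; set v := Num.max _ _.
have : 2^-1 + u <= v by rewrite le_max lexx orbT.
lra.
Unshelve. all: by end_near.
Qed.
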